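(* Let $M$ be a closed Kähler manifold of complex dimension $n$ with an $r$-fold $\mathbb{C}$-VCP, $r\ge1$. Then either (i) $r=n-1$ and $M$ is a Calabi-Yau manifold, or (ii) $r=1$ and $M$ is a hyperkähler manifold.
   Context: ''Closed manifold'' means compact without boundary. An $r$-fold complex vector cross product ($\mathbb{C}$-VCP) on a Hermitian complex manifold $(M,g,J)$ is a holomorphic form $\phi$ of degree $r+1$ ($\phi\in\Omega^{r+1,0}(M)$, $\bar\partial\phi=0$) such that $|\iota_{e_1\wedge\cdots\wedge e_r}\phi|=2^{(r+1)/2}$ for all $x\in M$ and all orthonormal $e_1,\dots,e_r\in T^{1,0}_xM$. Norms are the Hermitian extensions of the Riemannian ones, so in unitary coordinates $|dz^j|=\sqrt2$, and $(a-\sqrt{-1}Ja)/\sqrt2$ has unit length for a unit real tangent vector $a$. A Calabi-Yau manifold of complex dimension $n$ is a Kähler manifold with a parallel complex volume form, i.e. holonomy contained in $SU(n)$. A hyperkähler manifold is a Riemannian manifold of real dimension $4m$ with holonomy contained in $Sp(m)=GL(m,\mathbb{H})\cap SO(4m)$, i.e. with parallel Hermitian complex structures $I,J,K$ satisfying $I^2=J^2=K^2=IJK=-\mathrm{Id}$. *)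

(* Defs.v *)
From HB Require Import structures.
From mathcomp Require Import all_boot all_order all_algebra all_fingroup.
From mathcomp Require Import all_classical all_reals all_analysis.
From mathcomp Require Import complex.
Set Implicit Arguments.
Unset Strict Implicit.
Unset Printing Implicit Defensive.
Import Order.TTheory GRing.Theory Num.Theory.
Import numFieldNormedType.Exports.
Local Open Scope classical_set_scope.
Local Open Scope ring_scope.
Local Open Scope complex_scope.

(* Tensor fields on M are given by their components in each chart.  Tangent
   vectors are row vectors of components; an endomorphism with matrix B acts by
   v |-> v *m B, and a bilinear form with matrix G takes the value
   v *m G *m w^T on (v, w).  The fibre of TM (x) C is 'rV[R[i]]_N, and a complex
   form of degree p is given by its p-index components on the coordinate
   frame. *)

Fixpoint Ck_on (R : realType) (V W : normedModType R) (k : nat) (U : set V)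
    (f : V -> W) : Prop :=
  if k is k'.+1 then
    (forall z, U z -> differentiable f z) /\
    (forall v : V, Ck_on k' U (fun z => 'D_v f z))
  else forall z, U z -> {for z, continuous f}.

Definition smooth_on (R : realType) (V W : normedModType R) (U : set V)
    (f : V -> W) : Prop :=
  forall k, Ck_on k U f.

Definition partial (R : realType) (N : nat) (i : 'I_N) (f : 'rV[R]_N -> R)
    (z : 'rV[R]_N) : R :=
  'D_(delta_mx 0 i) f z.

Definition csmooth_on (R : realType) (N : nat) (U : set 'rV[R]_N)
    (f : 'rV[R]_N -> R[i]) : Prop :=
  smooth_on U (fun z => complex.Re (f z)) /\ smooth_on U (fun z => complex.Im (f z)).

Definition cpartial (R : realType) (N : nat) (i : 'I_N) (f : 'rV[R]_N -> R[i])
    (z : 'rV[R]_N) : R[i] :=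
  partial i (fun y => complex.Re (f y)) z +i* partial i (fun y => complex.Im (f y)) z.

(* Second countability is not required: it is automatic on the compact spaces
   considered here. *)
Record smoothAtlas (R : realType) (N : nat) (M : topologicalType) := SmoothAtlas {
  chart_index : Type;
  chart_dom : chart_index -> set M;
  chart : chart_index -> M -> 'rV[R]_N;
  chart_inv : chart_index -> 'rV[R]_N -> M;
  chart_dom_open : forall c, open (chart_dom c);
  chart_img_open : forall c, open (chart c @` chart_dom c);
  chartK : forall c x, chart_dom c x -> chart_inv c (chart c x) = x;
  chart_continuous : forall c x, chart_dom c x -> {for x, continuous (chart c)};
  chart_inv_continuous : forall c z, (chart c @` chart_dom c) z ->
    {for z, continuous (chart_inv c)};
  chart_cover : forall x, exists c, chart_dom c x;
  transition_smooth : forall c c',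
    smooth_on (chart c @` (chart_dom c `&` chart_dom c'))
              (chart c' \o chart_inv c)
}.

Definition chart_img (R : realType) (N : nat) (M : topologicalType)
    (A : smoothAtlas R N M) (c : chart_index A) : set 'rV[R]_N :=
  chart c @` chart_dom c.

(* A vector with components v in the chart c has components
   v *m transition_jac c c' x in the chart c'. *)
Definition transition_jac (R : realType) (N : nat) (M : topologicalType)
    (A : smoothAtlas R N M) (c c' : chart_index A) (x : M) : 'M[R]_N :=
  'J (chart c' \o chart_inv c) (chart c x).

(* Multiplication by the imaginary unit on C^n = R^n x R^n:
   row_mx x y *m std_J = row_mx (- y) x. *)
Definition std_J (R : realType) (n : nat) : 'M[R]_(n + n) :=
  block_mx 0 1%:M (- 1%:M) 0.

(* The transition maps are smooth by transition_smooth; the condition below is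
   the Cauchy-Riemann system.  The complex structure of the manifold then has
   the matrix std_J in every chart. *)
Definition holomorphic_atlas (R : realType) (n : nat) (M : topologicalType)
    (A : smoothAtlas R (n + n) M) : Prop :=
  forall (c c' : chart_index A) x, chart_dom c x -> chart_dom c' x ->
    std_J R n *m transition_jac c c' x = transition_jac c c' x *m std_J R n.

Definition matrixField (R : realType) (N : nat) (M : topologicalType)
    (A : smoothAtlas R N M) : Type := chart_index A -> M -> 'M[R]_N.

Definition smooth_matrixField (R : realType) (N : nat) (M : topologicalType)
    (A : smoothAtlas R N M) (B : matrixField A) : Prop :=
  forall c : chart_index A, smooth_on (chart_img c) (B c \o chart_inv c).

Record riemannian_metric (R : realType) (N : nat) (M : topologicalType)
    (A : smoothAtlas R N M) (g : matrixField A) : Prop := RiemannianMetric {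
  metric_smooth : smooth_matrixField g;
  metric_transition : forall (c c' : chart_index A) x,
    chart_dom c x -> chart_dom c' x ->
    g c x = transition_jac c c' x *m g c' x *m (transition_jac c c' x)^T;
  metric_sym : forall (c : chart_index A) x, chart_dom c x -> (g c x)^T = g c x;
  metric_pos : forall (c : chart_index A) x, chart_dom c x ->
    forall v : 'rV[R]_N, v != 0 -> 0 < (v *m g c x *m v^T) 0 0
}.

(* Gamma^l_{ij} for the metric G on an open subset of R^N. *)
Definition christoffel (R : realType) (N : nat) (G : 'rV[R]_N -> 'M[R]_N)
    (l i j : 'I_N) (z : 'rV[R]_N) : R :=
  2^-1 * \sum_(m < N) invmx (G z) l m *
    (partial i (fun y => G y j m) z + partial j (fun y => G y i m) z
     - partial m (fun y => G y i j) z).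

Definition metric_christoffel (R : realType) (N : nat) (M : topologicalType)
    (A : smoothAtlas R N M) (g : matrixField A) (c : chart_index A)
    (l i j : 'I_N) (x : M) : R :=
  christoffel (g c \o chart_inv c) l i j (chart c x).

Record endo_field (R : realType) (N : nat) (M : topologicalType)
    (A : smoothAtlas R N M) (B : matrixField A) : Prop := EndoField {
  endo_smooth : smooth_matrixField B;
  endo_transition : forall (c c' : chart_index A) x,
    chart_dom c x -> chart_dom c' x ->
    B c x *m transition_jac c c' x = transition_jac c c' x *m B c' x
}.

(* The i-th component of (nabla_k B)(d_j) = nabla_k (B d_j) - B (nabla_k d_j),
   where B d_j = \sum_i B j i d_i. *)
Definition nabla_endo (R : realType) (N : nat) (M : topologicalType)
    (A : smoothAtlas R N M) (g B : matrixField A) (c : chart_index A) (x : M)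
    (k j i : 'I_N) : R :=
  partial k (fun y => B c (chart_inv c y) j i) (chart c x)
  + \sum_(l < N) B c x j l * metric_christoffel g c i k l x
  - \sum_(l < N) metric_christoffel g c l k j x * B c x l i.

Definition parallel_endo (R : realType) (N : nat) (M : topologicalType)
    (A : smoothAtlas R N M) (g B : matrixField A) : Prop :=
  forall (c : chart_index A) x, chart_dom c x ->
    forall k j i, nabla_endo g B c x k j i = 0.

(* The matrix of the composite v |-> I (J (K v)) is K *m J *m I.  Integrability
   of I, J and K follows from parallelism. *)
Definition hyperkahler (R : realType) (N : nat) (M : topologicalType)
    (A : smoothAtlas R N M) (g : matrixField A) : Prop :=
  riemannian_metric g /\
  (exists m : nat, N = (4 * m)%N) /\
  exists I J K : matrixField A,
    [/\ endo_field I, endo_field J & endo_field K] /\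
    [/\ parallel_endo g I, parallel_endo g J & parallel_endo g K] /\
    forall (c : chart_index A) x, chart_dom c x ->
      [/\ I c x *m g c x *m (I c x)^T = g c x,
          J c x *m g c x *m (J c x)^T = g c x &
          K c x *m g c x *m (K c x)^T = g c x] /\
      [/\ I c x *m I c x = - 1%:M,
          J c x *m J c x = - 1%:M,
          K c x *m K c x = - 1%:M &
          K c x *m J c x *m I c x = - 1%:M].

Definition formField (R : realType) (N p : nat) (M : topologicalType)
    (A : smoothAtlas R N M) : Type :=
  chart_index A -> M -> {ffun 'I_p -> 'I_N} -> R[i].

Definition form_eval (R : realType) (N p : nat)
    (a : {ffun 'I_p -> 'I_N} -> R[i]) (e : 'I_p -> 'rV[R[i]]_N) : R[i] :=
  \sum_(i : {ffun 'I_p -> 'I_N}) a i * \prod_(k < p) e k 0 (i k).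

Record diff_form (R : realType) (N p : nat) (M : topologicalType)
    (A : smoothAtlas R N M) (phi : formField p A) : Prop := DiffForm {
  form_smooth : forall (c : chart_index A) i,
    csmooth_on (chart_img c) (fun z => phi c (chart_inv c z) i);
  form_alternating : forall (c : chart_index A) x, chart_dom c x ->
    forall (s : 'S_p) (i : {ffun 'I_p -> 'I_N}),
      phi c x [ffun k => i (s k)] = (-1) ^+ s * phi c x i;
  form_transition : forall (c c' : chart_index A) x,
    chart_dom c x -> chart_dom c' x ->
    forall i, phi c x i =
      form_eval (phi c' x)
        (fun k => map_mx (real_complex R) (row (i k) (transition_jac c c' x)))
}.

Definition nabla_form (R : realType) (N p : nat) (M : topologicalType)
    (A : smoothAtlas R N M) (g : matrixField A) (phi : formField p A)
    (c : chart_index A) (x : M) (k : 'I_N) (i : {ffun 'I_p -> 'I_N}) : R[i] :=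
  cpartial k (fun y => phi c (chart_inv c y) i) (chart c x)
  - \sum_(s < p) \sum_(l < N) (metric_christoffel g c l k (i s) x)%:C *
      phi c x [ffun t => if t == s then l else i t].

Definition parallel_form (R : realType) (N p : nat) (M : topologicalType)
    (A : smoothAtlas R N M) (g : matrixField A) (phi : formField p A) : Prop :=
  forall (c : chart_index A) x, chart_dom c x ->
    forall k i, nabla_form g phi c x k i = 0.

(* T^{1,0} and T^{0,1}: the eigenspaces of the complex structure for the
   eigenvalues 'i and - 'i. *)
Definition in_T10 (R : realType) (n : nat) (e : 'rV[R[i]]_(n + n)) : Prop :=
  e *m map_mx (real_complex R) (std_J R n) = 'i%C *: e.

Definition in_T01 (R : realType) (n : nat) (e : 'rV[R[i]]_(n + n)) : Prop :=
  e *m map_mx (real_complex R) (std_J R n) = - 'i%C *: e.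

Definition form_p0 (R : realType) (n p : nat) (M : topologicalType)
    (A : smoothAtlas R (n + n) M) (phi : formField p A) : Prop :=
  diff_form phi /\
  forall (c : chart_index A) x, chart_dom c x ->
    forall (e : 'I_p -> 'rV[R[i]]_(n + n)) k, in_T01 (e k) ->
      form_eval (phi c x) e = 0.

(* The Wirtinger derivative with respect to the conjugate of
   z_j = x_j + 'i * y_j, for the coordinates row_mx x y. *)
Definition dzbar (R : realType) (n : nat) (j : 'I_n)
    (f : 'rV[R]_(n + n) -> R[i]) (z : 'rV[R]_(n + n)) : R[i] :=
  2^-1 * (cpartial (lshift n j) f z + 'i%C * cpartial (rshift n j) f z).

(* For phi of type (p,0), the components of dbar phi are the values
   (dbar phi)(d/dzbar_j, d_{i_1}, ..., d_{i_p}) = d/dzbar_j (phi_{i_1 ... i_p}),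
   the coordinate fields being constant. *)
Definition holomorphic_form (R : realType) (n p : nat) (M : topologicalType)
    (A : smoothAtlas R (n + n) M) (phi : formField p A) : Prop :=
  form_p0 phi /\
  forall (c : chart_index A) x, chart_dom c x ->
    forall j i, dzbar j (fun y => phi c (chart_inv c y) i) (chart c x) = 0.

Definition hermitian_metric (R : realType) (n : nat) (M : topologicalType)
    (A : smoothAtlas R (n + n) M) (g : matrixField A) : Prop :=
  riemannian_metric g /\
  forall (c : chart_index A) x, chart_dom c x ->
    std_J R n *m g c x *m (std_J R n)^T = g c x.

(* omega(v, w) = g(J v, w) *)
Definition kahler_form (R : realType) (n : nat) (M : topologicalType)
    (A : smoothAtlas R (n + n) M) (g : matrixField A) : matrixField A :=
  fun c x => std_J R n *m g c x.

Definition kahler (R : realType) (n : nat) (M : topologicalType)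
    (A : smoothAtlas R (n + n) M) (g : matrixField A) : Prop :=
  holomorphic_atlas A /\ hermitian_metric g /\
  forall (c : chart_index A) x, chart_dom c x ->
    forall i j k : 'I_(n + n),
      let omega a b := fun y => kahler_form g c (chart_inv c y) a b in
      partial i (omega j k) (chart c x) + partial j (omega k i) (chart c x)
      + partial k (omega i j) (chart c x) = 0.

Definition complex_volume_form (R : realType) (n : nat) (M : topologicalType)
    (A : smoothAtlas R (n + n) M) (Omega : formField n A) : Prop :=
  form_p0 Omega /\
  forall (c : chart_index A) x, chart_dom c x -> exists i, Omega c x i != 0.

Definition calabi_yau (R : realType) (n : nat) (M : topologicalType)
    (A : smoothAtlas R (n + n) M) (g : matrixField A) : Prop :=
  kahler g /\
  exists Omega : formField n A, complex_volume_form Omega /\ parallel_form g Omega.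

(* Hermitian extension of the real inner product with matrix G. *)
Definition herm_dot (R : realType) (N : nat) (G : 'M[R]_N)
    (e f : 'rV[R[i]]_N) : R[i] :=
  (e *m map_mx (real_complex R) G *m (map_mx (@conjc R) f)^T) 0 0.

(* Norm of a complex covector for the Hermitian extension of the dual metric. *)
Definition conorm (R : realType) (N : nat) (G : 'M[R]_N) (a : 'rV[R[i]]_N) : R :=
  Num.sqrt (complex.Re (herm_dot (invmx G) a a)).

(* The 1-form phi(e_1, ..., e_r, -). *)
Definition contract (R : realType) (N r : nat)
    (a : {ffun 'I_r.+1 -> 'I_N} -> R[i]) (e : 'I_r -> 'rV[R[i]]_N) :
    'rV[R[i]]_N :=
  \row_(j < N) form_eval a
    (fun k => if unlift ord_max k is Some k' then e k' else delta_mx 0 j).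

Definition complex_vcp (R : realType) (n r : nat) (M : topologicalType)
    (A : smoothAtlas R (n + n) M) (g : matrixField A) (phi : formField r.+1 A) :
    Prop :=
  holomorphic_form phi /\
  forall (c : chart_index A) x, chart_dom c x ->
    forall e : 'I_r -> 'rV[R[i]]_(n + n),
      (forall k, in_T10 (e k)) ->
      (forall k l, herm_dot (g c x) (e k) (e l) = (k == l)%:R) ->
      conorm (g c x) (contract (phi c x) e) = Num.sqrt 2 ^+ r.+1.

(* Main.v *)
Require Import Defs.
From mathcomp Require Import all_boot all_order all_algebra all_fingroup.
From mathcomp Require Import all_classical all_reals all_analysis.
From mathcomp Require Import complex zify ring lra.

(** Let phi be a holomorphic form of type (r + 1, 0) satisfying the norm
    condition on a Kaehler manifold. The proof is pointwise linear algebra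
    followed by differentiating the norm condition once.

    Linear algebra. In a unitary frame of T^{1,0} (unitary_frame, vcp_pullback)
    the norm condition says that all covectors phi(e_1, ..., e_r, -), for
    orthonormal e_1, ..., e_r, have the same length c > 0. Since this holds
    over the complex numbers, it polarizes. If r = n, the contractions vanish
    (vcp_top_degree). If 2 <= r <= n - 2, polarization makes too many
    contractions mutually orthogonal (middle_degree_absurd). There remain r = 1
    and r = n - 1.

    Calculus. The Kaehler condition means that the matrices Gamma_k of the
    Levi-Civita connection commute with the complex structure J (gam_J); as the
    connection is torsion free, Gamma_{J k} = Gamma_k J as well (gam_swp).
    Together with the Cauchy-Riemann equations for the components of phi, this
    gives nabla_{J k} phi = i nabla_k phi.

    If r = n - 1, then phi = f dz_1 ... dz_n, and the norm condition becomes
    2^n |f|^2 = det H, where H is the Hermitian matrix of the metric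
    (top_norm). Let theta_k be the top component of nabla_k phi.
    Differentiating, with Jacobi's formula for det H, gives Re (theta_k conj f)
    = 0 for every real direction k, and theta_{J k} = i theta_k turns this into
    theta = 0 (top_parallel). So phi is a parallel volume form.

    If r = 1, the form with one index raised is an antilinear isometry. Its
    real part B satisfies B^2 = -1 and anticommutes with J (second_sq,
    second_anticomm), so J, B and - J B are quaternionic and orthogonal; the
    determinant of B over the complex numbers shows that n is even
    (quaternion_even). Differentiating B^2 = -1, nabla_k B anticommutes with B;
    so does nabla_{J k} B = J nabla_k B. Since J anticommutes with B too,
    nabla_k B also commutes with B, and it vanishes (anticomm_twice,
    second_parallel). *)

Set Implicit Arguments.
Unset Strict Implicit.
Unset Printing Implicit Defensive.
Import Order.TTheory GRing.Theory Num.Theory.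
Import numFieldNormedType.Exports.
Local Open Scope classical_set_scope.
Local Open Scope ring_scope.
Local Open Scope complex_scope.

(** * Functions of class C^k on an open set *)

Section Ck.
Variables (R : realType) (V : normedModType R) (U : set V).
Hypothesis oU : open U.

Lemma near_on (z : V) (P : V -> Prop) : U z -> (forall y, U y -> P y) ->
  \forall y \near z, P y.
Proof. by move=> Uz UP; near=> y; apply: UP; near: y; exact: open_nbhs_nbhs.
Unshelve. all: by end_near. Qed.

Lemma derive_eq_on (W : normedModType R) (f h : V -> W) (z v : V) : U z ->
  (forall y, U y -> f y = h y) -> 'D_v f z = 'D_v h z.
Proof. by move=> Uz fh; apply: near_eq_derive; exact: near_on. Qed.

(** Differentiability only depends on the germ: a function that vanishes near z
    is a little-o of the identity there. *)
Lemma differentiable_near0 (W : normedModType R) (k : V -> W) (z : V) :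
  (\forall y \near z, k y = 0) -> differentiable k z.
Proof.
move=> k0; have kz : k z = 0 by exact: nbhs_singleton k0.
have k0' : \forall h \near 0, k (h + z) = 0.
  by move: k0; rewrite (near_shift 0 z); apply: filterS => h /=; rewrite subr0.
have c0 : continuous (\0 : V -> W) by exact: cst_continuous.
have E : k \o shift z = cst (k z) + (\0 : V -> W) +o_ (0 : V) id.
  rewrite kz; apply/eqaddoP => e e0; near=> h; rewrite !fctE /= addr0 subr0.
  by rewrite (near k0' h) // normr0 mulr_ge0 // ltW.
apply/diff_locallyP; rewrite (diff_unique _ E) //; exact: c0.
Unshelve. all: by end_near. Qed.

Lemma differentiable_eq_on (W : normedModType R) (f h : V -> W) (z : V) : U z ->
  (forall y, U y -> f y = h y) -> differentiable f z -> differentiable h z.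
Proof.
move=> Uz fh df.
have -> : h = f + (h - f) by apply/funext => y; rewrite !fctE addrC subrK.
apply: differentiableD => //; apply: differentiable_near0; apply: (near_on Uz).
by move=> y /fh fy; rewrite !fctE fy subrr.
Qed.

Lemma Ck_on_eq (W : normedModType R) k (f h : V -> W) :
  (forall y, U y -> f y = h y) -> Ck_on k U f -> Ck_on k U h.
Proof.
elim: k f h => [|k IHk] f h fh /= => [cf z Uz|[df Df]].
  have := cf z Uz; rewrite /prop_for /continuous_at fh //.
  apply: cvg_trans; apply: near_eq_cvg; exact: near_on.
split=> [z Uz|v]; first exact: differentiable_eq_on (df z Uz).
apply: IHk (Df v) => z Uz; exact: derive_eq_on.
Qed.

Lemma Ck_on_cst (W : normedModType R) k (a : W) : Ck_on k U (fun=> a).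
Proof.
elim: k a => [|k IHk] a /=; first by move=> z _; exact: cst_continuous.
split=> [z _|v]; first exact: differentiable_cst.
apply: Ck_on_eq (IHk 0) => z _; symmetry; exact: derive_cst.
Qed.

Lemma Ck_onW (W : normedModType R) k (f : V -> W) :
  Ck_on k.+1 U f -> Ck_on k U f.
Proof.
elim: k f => [|k IHk] f [df Df].
  by move=> z Uz; exact/differentiable_continuous/df.
by split=> // v; exact/IHk/Df.
Qed.

Lemma Ck_onD (W : normedModType R) k (f h : V -> W) :
  Ck_on k U f -> Ck_on k U h -> Ck_on k U (fun z => f z + h z).
Proof.
elim: k f h => [|k IHk] f h => [cf ch z Uz|[df Df] [dh Dh]].
  by apply: continuousD; [exact: cf | exact: ch].
split=> [z Uz|v]; first by apply: differentiableD; [exact: df | exact: dh].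
apply: Ck_on_eq (IHk _ _ (Df v) (Dh v)) => z Uz.
by symmetry; apply: deriveD; apply: diff_derivable; [exact: df | exact: dh].
Qed.

Lemma Ck_onZ (W : normedModType R) k (a : R) (f : V -> W) :
  Ck_on k U f -> Ck_on k U (fun z => a *: f z).
Proof.
elim: k f => [|k IHk] f => [cf z Uz|[df Df]].
  by apply: continuousZ (cf z Uz); exact: cst_continuous.
split=> [z Uz|v]; first by apply: differentiableZ; exact: df.
apply: Ck_on_eq (IHk _ (Df v)) => z Uz.
by symmetry; apply: deriveZ; apply: diff_derivable; exact: df.
Qed.

Lemma Ck_onM k (f h : V -> R) :
  Ck_on k U f -> Ck_on k U h -> Ck_on k U (fun z => f z * h z).
Proof.
elim: k f h => [|k IHk] f h.
  by move=> cf ch z Uz; apply: continuousM; [exact: cf | exact: ch].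
move=> Cf Ch; have [df Df] := Cf; have [dh Dh] := Ch.
split=> [z Uz|v]; first by apply: differentiableM; [exact: df | exact: dh].
apply: Ck_on_eq (Ck_onD (IHk _ _ (Ck_onW Cf) (Dh v))
  (IHk _ _ (Ck_onW Ch) (Df v))) => z Uz.
by symmetry; apply: deriveM; apply: diff_derivable; [exact: df | exact: dh].
Qed.

(** The derivative - f^-2 * D_v f involves f^-1 itself, one order lower. *)
Lemma Ck_onV k (f : V -> R) : (forall z, U z -> f z != 0) ->
  Ck_on k U f -> Ck_on k U (fun z => (f z)^-1).
Proof.
move=> f0; elim: k => [|k IHk].
  by move=> cf z Uz; apply: continuousV; [exact: f0 | exact: cf].
move=> Cf; have [df Df] := Cf; have Ci := IHk (Ck_onW Cf).
split=> [z Uz|v]; first by apply: differentiableV; [exact: df | exact: f0].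
apply: Ck_on_eq (Ck_onZ (-1) (Ck_onM (Ck_onM Ci Ci) (Df v))) => z Uz.
rewrite deriveV; [|exact: f0|exact/diff_derivable/df].
by rewrite scaleN1r scaleNr expr2 invfM.
Qed.

Lemma Ck_on_sum (W : normedModType R) k (I : Type) (r : seq I) (P : pred I)
    (f : I -> V -> W) :
  (forall i, Ck_on k U (f i)) -> Ck_on k U (fun z => \sum_(i <- r | P i) f i z).
Proof.
move=> Cf; elim: r => [|i r IHr].
  by under eq_fun do rewrite big_nil; exact: Ck_on_cst.
under eq_fun do rewrite big_cons.
by case: (P i) => //; exact: Ck_onD.
Qed.

Lemma Ck_on_prod k (I : Type) (r : seq I) (P : pred I) (f : I -> V -> R) :
  (forall i, Ck_on k U (f i)) -> Ck_on k U (fun z => \prod_(i <- r | P i) f i z).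
Proof.
move=> Cf; elim: r => [|i r IHr].
  by under eq_fun do rewrite big_nil; exact: Ck_on_cst.
under eq_fun do rewrite big_cons.
by case: (P i) => //; exact: Ck_onM.
Qed.

Lemma Ck_on_entry m n k (B : V -> 'M[R]_(m, n)) i j :
  Ck_on k U B -> Ck_on k U (fun z => B z i j).
Proof.
elim: k B => [|k IHk] B.
  move=> cB z Uz.
  apply: (@continuous_comp _ _ _ B (fun M : 'M[R]_(m, n) => M i j)).
    exact: cB.
  exact: coord_continuous.
move=> [dB DB]; split=> [z Uz|v].
  apply: (@differentiable_comp _ _ _ _ B (fun M : 'M[R]_(m, n) => M i j)).
    exact: dB.
  exact: differentiable_coord.
apply: Ck_on_eq (IHk _ (DB v)) => z Uz.
by rewrite derive_mx ?mxE //; apply: diff_derivable; exact: dB.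
Qed.

Lemma Ck_on_scale_mx m n k (f : V -> R) (D : 'M[R]_(m, n)) :
  Ck_on k U f -> Ck_on k U (fun z => f z *: D).
Proof.
elim: k f => [|k IHk] f.
  by move=> cf z Uz; apply: continuousZ (cf z Uz) _; exact: cst_continuous.
move=> [df Df]; split=> [z Uz|v]; first by apply: differentiableZl; exact: df.
apply: Ck_on_eq (IHk _ (Df v)) => z Uz.
have dfz : derivable f z v by apply: diff_derivable; exact: df.
have d i j : derivable (fun y => (f y *: D) i j) z v.
  under eq_fun do rewrite mxE mulrC.
  exact: (@derivableZ _ _ _ f (D i j)).
rewrite derive_mx; last exact/derivable_mxP.
apply/matrixP => i j; rewrite !mxE.
under eq_fun do rewrite mxE mulrC.
by rewrite (@deriveZ _ _ _ f (D i j)) // mulrC.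
Qed.

Lemma Ck_on_mx m n k (B : V -> 'M[R]_(m, n)) :
  (forall i j, Ck_on k U (fun z => B z i j)) -> Ck_on k U B.
Proof.
move=> CB.
have -> : B = fun z => \sum_i \sum_j B z i j *: delta_mx i j.
  by apply/funext => z; exact: matrix_sum_delta.
by apply: Ck_on_sum => i; apply: Ck_on_sum => j; exact: Ck_on_scale_mx.
Qed.

Lemma Ck_on_mulmx m n p k (B : V -> 'M[R]_(m, n)) (D : V -> 'M[R]_(n, p)) :
  Ck_on k U B -> Ck_on k U D -> Ck_on k U (fun z => B z *m D z).
Proof.
move=> CB CD; apply: Ck_on_mx => i j; under eq_fun do rewrite mxE.
by apply: Ck_on_sum => l; apply: Ck_onM; exact: Ck_on_entry.
Qed.

Lemma Ck_on_det n k (B : V -> 'M[R]_n) :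
  (forall i j, Ck_on k U (fun z => B z i j)) -> Ck_on k U (fun z => \det (B z)).
Proof.
move=> CB; apply: Ck_on_sum => s; apply: Ck_onM; first exact: Ck_on_cst.
exact: Ck_on_prod.
Qed.

(** Cramer's rule expresses the entries of the inverse through determinants. *)
Lemma Ck_on_invmx n k (B : V -> 'M[R]_n) :
  (forall z, U z -> B z \in unitmx) ->
  Ck_on k U B -> Ck_on k U (fun z => invmx (B z)).
Proof.
move=> uB CB.
apply: (@Ck_on_eq _ _ (fun z => (\det (B z))^-1 *: \adj (B z))).
  by move=> z /uB uz; rewrite /invmx uz.
apply: Ck_on_mx => i j; under eq_fun do rewrite mxE.
apply: Ck_onM.
  apply: Ck_onV; first by move=> z /uB; rewrite unitmxE unitfE.
  by apply: Ck_on_det => *; exact: Ck_on_entry.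
under eq_fun do rewrite mxE.
apply: Ck_onM; first exact: Ck_on_cst.
apply: Ck_on_det => a b; under eq_fun do rewrite !mxE.
exact: Ck_on_entry.
Qed.

End Ck.

(** * Derivations at a point and the derivative of a determinant *)

Section Jacobi.
Variables (K : comNzRingType) (n : nat).
Implicit Types B X : 'M[K]_n.

Lemma det_replace_row B i (v : 'I_n -> K) :
  \det (\matrix_(k, l) if k == i then v l else B k l)
  = \sum_j v j * cofactor B i j.
Proof.
rewrite (expand_det_row _ i); apply: eq_bigr => j _; rewrite !mxE eqxx /cofactor.
congr (_ * (_ * \det _)).
by apply/matrixP => a b; rewrite !mxE eq_sym (negPf (neq_lift _ _)).
Qed.

Lemma sum_det_replace_row B X :
  \sum_i \det (\matrix_(k, l) if k == i then X k l else B k l)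
  = \tr (X *m \adj B).
Proof.
apply: eq_bigr => i _; rewrite [RHS]mxE.
under [RHS]eq_bigr => j _ do rewrite [\adj B _ _]mxE.
rewrite -det_replace_row; congr determinant; apply/matrixP => k l; rewrite !mxE.
by case: eqP => [->|].
Qed.

Lemma mxtrace_mul_adjl B X : \tr (B *m X *m \adj B) = \tr X * \det B.
Proof.
by rewrite mxtrace_mulC mulmxA mul_adj_mx mul_scalar_mx mxtraceZ mulrC.
Qed.

Lemma mxtrace_mul_adjr B X : \tr (X *m B *m \adj B) = \tr X * \det B.
Proof. by rewrite -mulmxA mul_mx_adj mul_mx_scalar mxtraceZ mulrC. Qed.
End Jacobi.

(** Partial derivatives of real functions and of complex functions (through real
    and imaginary parts) obey the same rules, so the calculus of sums, products
    and determinants is developed once, for an operator D defined on the class S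
    and satisfying the Leibniz rule at z. *)
Record derivation_at (T : Type) (K : comNzRingType) (z : T)
    (S : (T -> K) -> Prop) (D : (T -> K) -> K) : Prop := DerivationAt {
  der_dom_cst : forall a, S (fun=> a);
  der_dom_add : forall f h, S f -> S h -> S (fun y => f y + h y);
  der_dom_mul : forall f h, S f -> S h -> S (fun y => f y * h y);
  der_cst : forall a, D (fun=> a) = 0;
  der_add : forall f h, S f -> S h -> D (fun y => f y + h y) = D f + D h;
  der_mul : forall f h, S f -> S h ->
    D (fun y => f y * h y) = D f * h z + f z * D h
}.

Section Derivation.
Variables (T : Type) (K : comNzRingType) (z : T).
Variables (S : (T -> K) -> Prop) (D : (T -> K) -> K).
Hypothesis dD : derivation_at z S D.

Lemma der_dom_sum (I : Type) (r : seq I) (P : pred I) (f : I -> T -> K) :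
  (forall i, S (f i)) -> S (fun y => \sum_(i <- r | P i) f i y).
Proof.
move=> Sf; elim: r => [|i r IHr].
  by under eq_fun do rewrite big_nil; exact: (der_dom_cst dD).
under eq_fun do rewrite big_cons.
by case: (P i) => //; exact: (der_dom_add dD).
Qed.

Lemma der_sum (I : Type) (r : seq I) (P : pred I) (f : I -> T -> K) :
  (forall i, S (f i)) ->
  D (fun y => \sum_(i <- r | P i) f i y) = \sum_(i <- r | P i) D (f i).
Proof.
move=> Sf; elim: r => [|i r IHr].
  by under eq_fun do rewrite big_nil; rewrite big_nil (der_cst dD).
under eq_fun do rewrite big_cons.
rewrite big_cons; case: (P i) => //.
by rewrite (der_add dD) ?IHr //; exact: der_dom_sum.
Qed.

Lemma der_dom_prod (I : Type) (r : seq I) (f : I -> T -> K) :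
  (forall i, S (f i)) -> S (fun y => \prod_(i <- r) f i y).
Proof.
move=> Sf; elim: r => [|i r IHr].
  by under eq_fun do rewrite big_nil; exact: (der_dom_cst dD).
by under eq_fun do rewrite big_cons; exact: (der_dom_mul dD).
Qed.

Lemma der_prod (I : eqType) (r : seq I) (f : I -> T -> K) : uniq r ->
  (forall i, S (f i)) ->
  D (fun y => \prod_(i <- r) f i y)
  = \sum_(i <- r) D (f i) * \prod_(j <- r | j != i) f j z.
Proof.
move=> + Sf; elim: r => [|i r IHr] /=.
  by move=> _; under eq_fun do rewrite big_nil; rewrite big_nil (der_cst dD).
move=> /andP[ir ur]; under eq_fun do rewrite big_cons.
rewrite (der_mul dD) //; last exact: der_dom_prod.
rewrite IHr // !big_cons eqxx /=; congr (_ * _ + _).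
  rewrite [RHS]big_seq_cond [LHS]big_seq; apply: eq_bigl => j.
  by case: eqP => [->|]; rewrite ?(negPf ir) ?andbT.
rewrite mulr_sumr; apply: eq_big_seq => j jr /=.
have ij : i != j by apply: contraNneq ir => ->.
by rewrite big_cons ij mulrCA.
Qed.

Definition dermx m n (B : T -> 'M[K]_(m, n)) : 'M[K]_(m, n) :=
  \matrix_(i, j) D (fun y => B y i j).

Lemma dermx_mul m n p (B : T -> 'M[K]_(m, n)) (E : T -> 'M[K]_(n, p)) :
  (forall i j, S (fun y => B y i j)) -> (forall i j, S (fun y => E y i j)) ->
  dermx (fun y => B y *m E y) = dermx B *m E z + B z *m dermx E.
Proof.
move=> SB SE; apply/matrixP => i j; rewrite !mxE.
under [X in D X]eq_fun do rewrite mxE.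
rewrite der_sum; last by move=> l; exact: (der_dom_mul dD).
rewrite -big_split; apply: eq_bigr => l _ /=.
by rewrite (der_mul dD) // !mxE.
Qed.

Lemma der_dom_mulmx m n p (B : T -> 'M[K]_(m, n)) (E : T -> 'M[K]_(n, p)) :
  (forall i j, S (fun y => B y i j)) -> (forall i j, S (fun y => E y i j)) ->
  forall i j, S (fun y => (B y *m E y) i j).
Proof.
move=> SB SE i j; under eq_fun do rewrite mxE.
by apply: der_dom_sum => l; exact: (der_dom_mul dD).
Qed.

Lemma dermx_cst m n (B : 'M[K]_(m, n)) : dermx (fun=> B) = 0.
Proof. by apply/matrixP => i j; rewrite !mxE (der_cst dD). Qed.

(** Jacobi's formula. *)
Lemma der_det n (B : T -> 'M[K]_n) : (forall i j, S (fun y => B y i j)) ->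
  D (fun y => \det (B y)) = \tr (dermx B *m \adj (B z)).
Proof.
move=> SB; rewrite -sum_det_replace_row /determinant der_sum; last first.
  move=> s; apply: (der_dom_mul dD); first exact: (der_dom_cst dD).
  exact: der_dom_prod.
rewrite exchange_big; apply: eq_bigr => s _ /=.
rewrite (der_mul dD); [|exact: (der_dom_cst dD)|exact: der_dom_prod].
rewrite (der_cst dD) mul0r add0r -mulr_sumr; congr (_ * _).
rewrite der_prod ?index_enum_uniq //; apply: eq_bigr => i _.
rewrite [RHS](bigD1 i) //= !mxE eqxx; congr (_ * _).
by apply: eq_bigr => j /negPf ji; rewrite mxE ji.
Qed.

End Derivation.

Section Partial.
Variables (R : realType) (N : nat) (k : 'I_N) (z : 'rV[R]_N).

Definition pderivable (f : 'rV[R]_N -> R) := derivable f z (delta_mx 0 k).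

Lemma partial_derivation :
  derivation_at z pderivable (fun f => partial k f z).
Proof.
split=> [a|f h|f h|a|f h|f h].
- exact: derivable_cst.
- exact: derivableD.
- exact: derivableM.
- exact: derive_cst.
- exact: deriveD.
- by move=> df dh; rewrite /partial deriveM // addrC ![_ *: _]mulrC [_ * f z]mulrC.
Qed.

Definition cpderivable (f : 'rV[R]_N -> R[i]) :=
  pderivable (fun y => complex.Re (f y)) /\ pderivable (fun y => complex.Im (f y)).

Lemma ReD (a b : R[i]) :
  complex.Re (a + b) = complex.Re a + complex.Re b.
Proof. by case: a b => ? ? [? ?]. Qed.

Lemma ImD (a b : R[i]) :
  complex.Im (a + b) = complex.Im a + complex.Im b.
Proof. by case: a b => ? ? [? ?]. Qed.

Lemma ReM (a b : R[i]) : complex.Re (a * b)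
  = complex.Re a * complex.Re b - complex.Im a * complex.Im b.
Proof. by case: a b => ? ? [? ?]. Qed.

Lemma ImM (a b : R[i]) : complex.Im (a * b)
  = complex.Re a * complex.Im b + complex.Im a * complex.Re b.
Proof. by case: a b => ? ? [? ?]. Qed.

Lemma partialN (f : 'rV[R]_N -> R) : pderivable f ->
  partial k (fun y => - f y) z = - partial k f z.
Proof. exact: deriveN. Qed.

Lemma cpartial_derivation :
  derivation_at z cpderivable (fun f => cpartial k f z).
Proof.
have d := partial_derivation.
have dN f : pderivable f -> pderivable (fun y => - f y) by exact: derivableN.
have M f h : cpderivable f -> cpderivable h -> cpderivable (fun y => f y * h y).
  move=> [rf jf] [rh jh]; split.
    under eq_fun do rewrite ReM.
    apply: (der_dom_add d); first exact: (der_dom_mul d).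
    by apply: dN; exact: (der_dom_mul d).
  under eq_fun do rewrite ImM.
  by apply: (der_dom_add d); exact: (der_dom_mul d).
split=> [a|f h|//|a|f h|f h].
- by split; exact: (der_dom_cst d).
- move=> [rf jf] [rh jh]; split.
    by under eq_fun do rewrite ReD; exact: (der_dom_add d).
  by under eq_fun do rewrite ImD; exact: (der_dom_add d).
- by rewrite /cpartial !(der_cst d).
- move=> [rf jf] [rh jh]; rewrite /cpartial.
  under [X in partial k X z +i* _]eq_fun do rewrite ReD.
  under [X in _ +i* partial k X z]eq_fun do rewrite ImD.
  by rewrite (der_add d rf rh) (der_add d jf jh).
- move=> [rf jf] [rh jh]; rewrite /cpartial.
  under [X in partial k X z +i* _]eq_fun do rewrite ReM.
  under [X in _ +i* partial k X z]eq_fun do rewrite ImM.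
  have [rr jj] := (der_dom_mul d rf rh, der_dom_mul d jf jh).
  have [rj jr] := (der_dom_mul d rf jh, der_dom_mul d jf rh).
  rewrite (der_add d rr (dN _ jj)) (der_add d rj jr) (partialN jj).
  rewrite (der_mul d rf rh) (der_mul d jf jh) (der_mul d rf jh) (der_mul d jf rh).
  apply/eqP; rewrite eq_complex /=.
  by case: (f z) (h z) => [a b] [a' b'] /=; apply/andP; split; apply/eqP; ring.
Qed.

End Partial.

(** * Evaluation of forms on vectors *)

Section FormEval.
Variables (R : realType) (N p : nat).
Implicit Types (a : {ffun 'I_p -> 'I_N} -> R[i]) (e : 'I_p -> 'rV[R[i]]_N).

Definition upd e (k : 'I_p) v : 'I_p -> 'rV[R[i]]_N :=
  fun j => if j == k then v else e j.

Lemma form_eval_eq a e e' : e =1 e' -> form_eval a e = form_eval a e'.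
Proof.
move=> ee; apply: eq_bigr => i _; congr (_ * _).
by apply: eq_bigr => k _; rewrite ee.
Qed.

Lemma form_eval_updE a e k v : form_eval a (upd e k v) =
  \sum_(i : {ffun 'I_p -> 'I_N}) a i * (v 0 (i k) * \prod_(j | j != k) e j 0 (i j)).
Proof.
apply: eq_bigr => i _; rewrite (bigD1 k) //= /upd eqxx; congr (_ * (_ * _)).
by apply: eq_bigr => j /negPf ->.
Qed.

Lemma form_eval_updD a e k v w :
  form_eval a (upd e k (v + w))
  = form_eval a (upd e k v) + form_eval a (upd e k w).
Proof.
rewrite !form_eval_updE -big_split; apply: eq_bigr => i _ /=.
by rewrite mxE mulrDl mulrDr.
Qed.

Lemma form_eval_updZ a e k c v :
  form_eval a (upd e k (c *: v)) = c * form_eval a (upd e k v).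
Proof.
rewrite !form_eval_updE mulr_sumr; apply: eq_bigr => i _ /=.
by rewrite mxE -mulrA mulrCA.
Qed.

Lemma form_eval_updB a e k v w :
  form_eval a (upd e k (v - w))
  = form_eval a (upd e k v) - form_eval a (upd e k w).
Proof. by rewrite -scaleN1r form_eval_updD form_eval_updZ mulN1r. Qed.

Lemma form_eval_delta a (i : {ffun 'I_p -> 'I_N}) :
  form_eval a (fun k => delta_mx 0 (i k)) = a i.
Proof.
rewrite /form_eval (bigD1 i) //= [X in _ + X]big1 ?addr0 => [|j /eqP ji].
  by rewrite big1 ?mulr1 // => k _; rewrite mxE !eqxx.
have [k jk] : exists k, j k != i k.
  apply/existsP; rewrite -negb_forall; apply: contra_notN ji => /forallP jk.
  by apply/ffunP => k; apply/eqP; exact: jk.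
by rewrite (bigD1 k) //= mxE (negPf jk) andbF mul0r mulr0.
Qed.

(** The slots are replaced one at a time; each step changes the value by the
    value on a tuple containing a vector that kills the form. *)
Lemma form_eval_congr a (Kill : 'rV[R[i]]_N -> Prop) e e' :
  (forall f k, Kill (f k) -> form_eval a f = 0) ->
  (forall k, Kill (e k - e' k)) -> form_eval a e = form_eval a e'.
Proof.
move=> a0 ee'; pose w (m : nat) (k : 'I_p) := if (k < m)%N then e' k else e k.
have step m : (m <= p)%N -> form_eval a (w m) = form_eval a e.
  elim: m => [_|m IHm lmp]; first exact: form_eval_eq.
  rewrite -IHm 1?ltnW //; pose k := Ordinal lmp.
  have E x : upd (w m) k x k = x by rewrite /upd eqxx.
  have wE : form_eval a (w m) = form_eval a (upd (w m) k (e k)).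
    apply: form_eval_eq => j; rewrite /upd /w; case: eqP => [->|//].
    by rewrite /= ltnn.
  have wE' : form_eval a (w m.+1) = form_eval a (upd (w m) k (e' k)).
    apply: form_eval_eq => j; rewrite /upd /w ltnS leq_eqVlt.
    rewrite -(inj_eq val_inj) /=; case: eqP => [jm|//] /=.
    by congr e'; exact: val_inj.
  apply/esym/eqP; rewrite -subr_eq0 wE wE' -form_eval_updB; apply/eqP.
  by apply: (a0 _ k); rewrite E.
rewrite -(step _ (leqnn p)); apply: form_eval_eq => k.
by rewrite /w ltn_ord.
Qed.

Definition alternating_form a := forall (s : 'S_p) (i : {ffun 'I_p -> 'I_N}),
  a [ffun k => i (s k)] = (-1) ^+ s * a i.

Lemma form_eval_perm a e (s : 'S_p) : alternating_form a ->
  form_eval a (fun k => e (s k)) = (-1) ^+ s * form_eval a e.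
Proof.
move=> alt; rewrite /form_eval mulr_sumr.
pose h (i : {ffun 'I_p -> 'I_N}) := [ffun k => i (s k)].
rewrite (reindex h) /=; last first.
  exists (fun i : {ffun 'I_p -> 'I_N} => [ffun k => i ((s^-1)%g k)]) => i _;
  by apply/ffunP => k; rewrite !ffunE ?permKV ?permK.
apply: eq_bigr => i _; rewrite alt -mulrA; congr (_ * (_ * _)).
rewrite [RHS](reindex_perm s) /=.
by apply: eq_bigr => k _; rewrite ffunE.
Qed.

Lemma form_eval_repeat a e k l : alternating_form a -> k != l -> e k = e l ->
  form_eval a e = 0.
Proof.
move=> alt kl ekl; have := form_eval_perm e (tperm k l) alt.
rewrite odd_tperm kl expr1 mulN1r.
have -> : form_eval a (fun j => e (tperm k l j)) = form_eval a e.
  by apply: form_eval_eq => j; case: tpermP => [->|->|].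
by move/eqP; rewrite -addr_eq0 -mulr2n mulrn_eq0 => /eqP.
Qed.

End FormEval.

Section Pullback.
Variables (R : realType) (N m p : nat).

Definition pullback (a : {ffun 'I_p -> 'I_N} -> R[i]) (F : 'M[R[i]]_(m, N))
    (i : {ffun 'I_p -> 'I_m}) : R[i] :=
  form_eval a (fun k => row (i k) F).

Lemma form_eval_pullback a F u :
  form_eval (pullback a F) u = form_eval a (fun k => u k *m F).
Proof.
rewrite /form_eval /pullback /form_eval.
under eq_bigr => i _ do rewrite mulr_suml.
rewrite exchange_big; apply: eq_bigr => i _ /=.
under [in RHS]eq_bigr => k _ do rewrite mxE.
rewrite (bigA_distr_bigA (fun k j => u k 0 j * F j (i k))) mulr_sumr.
apply: eq_bigr => j _; rewrite -mulrA; congr (_ * _).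
by rewrite big_split mulrC; congr (_ * _); apply: eq_bigr => k _; rewrite mxE.
Qed.

Lemma pullback_alternating_form a F : alternating_form a -> alternating_form (pullback a F).
Proof.
move=> alt s i; rewrite /pullback -(form_eval_perm _ s alt).
by apply: form_eval_eq => k; rewrite ffunE.
Qed.

End Pullback.

Section TopForm.
Variables (R : realType) (n : nat).

(** Multi-indices with a repetition contribute zero; the others are
    permutations, and the sum over them is the Leibniz formula. *)
Lemma form_eval_top (a : {ffun 'I_n -> 'I_n} -> R[i]) (B : 'M[R[i]]_n) :
  alternating_form a -> form_eval a (fun k => row k B) = \det B * a [ffun k => k].
Proof.
move=> alt.
have a0 (i : {ffun 'I_n -> 'I_n}) : ~~ injectiveb i -> a i = 0.
  move=> /injectivePn [k [l kl ikl]].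
  have := form_eval_delta a i; rewrite (@form_eval_repeat _ _ _ a _ k l) //.
  by rewrite ikl.
rewrite /form_eval (bigID (fun i : {ffun 'I_n -> 'I_n} => injectiveb i)) /=.
rewrite [X in _ + X]big1 ?addr0 => [|i /a0 ->]; last by rewrite mul0r.
rewrite (reindex (@pval _)) /=; last first.
  pose in_Sn := insubd (1%g : 'S_n).
  by exists in_Sn => /= f Uf; first apply: val_inj; apply: insubdK.
rewrite mulr_suml; apply: eq_big => /= [s | s _]; first by rewrite (valP s).
have -> : pval s = [ffun k => [ffun k => k] (s k)].
  by apply/ffunP => k; rewrite !ffunE pvalE.
rewrite alt mulrAC; congr (_ * _ * _).
by apply: eq_bigr => k _; rewrite !ffunE mxE.
Qed.

End TopForm.

(** * Hermitian linear algebra and the admissible degrees *)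

Section Adjoint.
Variable R : realType.
Local Notation C := R[i].

Definition adjmx m n (B : 'M[C]_(m, n)) : 'M[C]_(n, m) :=
  (map_mx (@conjc R) B)^T.

Lemma adjmxE m n (B : 'M[C]_(m, n)) i j : adjmx B i j = conjc (B j i).
Proof. by rewrite !mxE. Qed.

Lemma adjmxM m n p (B : 'M[C]_(m, n)) (D : 'M[C]_(n, p)) :
  adjmx (B *m D) = adjmx D *m adjmx B.
Proof. by rewrite /adjmx map_mxM trmx_mul. Qed.

Lemma adjmxK m n (B : 'M[C]_(m, n)) : adjmx (adjmx B) = B.
Proof. by apply/matrixP => i j; rewrite !adjmxE conjcK. Qed.

Lemma adjmxD m n (B D : 'M[C]_(m, n)) : adjmx (B + D) = adjmx B + adjmx D.
Proof. by rewrite /adjmx map_mxD raddfD. Qed.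

Lemma adjmxZ m n c (B : 'M[C]_(m, n)) : adjmx (c *: B) = conjc c *: adjmx B.
Proof. by apply/matrixP => i j; rewrite !mxE rmorphM. Qed.

Lemma adjmx1 n : adjmx (1%:M : 'M[C]_n) = 1%:M.
Proof. by rewrite /adjmx map_mx1 trmx1. Qed.

Lemma adjmx_row_mx m n p (B : 'M[C]_(m, n)) (D : 'M[C]_(m, p)) :
  adjmx (row_mx B D) = col_mx (adjmx B) (adjmx D).
Proof. by rewrite /adjmx map_row_mx tr_row_mx. Qed.

Lemma adjmx_real m n (B : 'M[R]_(m, n)) :
  adjmx (map_mx (real_complex R) B) = map_mx (real_complex R) B^T.
Proof. by apply/matrixP => i j; rewrite !mxE conjc_real. Qed.

Lemma conjcM (x y : C) : conjc (x * y) = conjc x * conjc y.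
Proof. exact: rmorphM. Qed.

Lemma conjcD (x y : C) : conjc (x + y) = conjc x + conjc y.
Proof. exact: rmorphD. Qed.

Lemma conjcN (x : C) : conjc (- x) = - conjc x.
Proof. exact: rmorphN. Qed.

Definition sprod n (u v : 'rV[C]_n) : C := (u *m adjmx v) 0 0.

Lemma sprodE n (u v : 'rV[C]_n) : sprod u v = \sum_k u 0 k * conjc (v 0 k).
Proof. by rewrite /sprod mxE; apply: eq_bigr => k _; rewrite adjmxE. Qed.

Lemma sprodC n (u v : 'rV[C]_n) : sprod u v = conjc (sprod v u).
Proof.
rewrite !sprodE rmorph_sum; apply: eq_bigr => k _.
by rewrite /= conjcM conjcK mulrC.
Qed.

Lemma sprodDl n (u v w : 'rV[C]_n) : sprod (u + v) w = sprod u w + sprod v w.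
Proof. by rewrite /sprod mulmxDl mxE. Qed.

Lemma sprodDr n (u v w : 'rV[C]_n) : sprod w (u + v) = sprod w u + sprod w v.
Proof. by rewrite /sprod adjmxD mulmxDr mxE. Qed.

Lemma sprodZl n c (u v : 'rV[C]_n) : sprod (c *: u) v = c * sprod u v.
Proof. by rewrite /sprod -scalemxAl mxE. Qed.

Lemma sprodZr n c (u v : 'rV[C]_n) : sprod u (c *: v) = conjc c * sprod u v.
Proof. by rewrite /sprod adjmxZ -scalemxAr mxE. Qed.

Lemma sprod0l n (v : 'rV[C]_n) : sprod 0 v = 0.
Proof. by rewrite /sprod mul0mx mxE. Qed.

Lemma sprod_ge0 n (v : 'rV[C]_n) : 0 <= sprod v v.
Proof. by rewrite sprodE; apply: sumr_ge0 => k _; exact: mulcJ_ge0. Qed.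

Lemma sprod_eq0 n (v : 'rV[C]_n) : sprod v v = 0 -> v = 0.
Proof.
rewrite sprodE => /eqP; rewrite psumr_eq0 => [/allP v0|k _]; last first.
  exact: mulcJ_ge0.
apply/rowP => k; rewrite mxE; have := v0 k; rewrite mem_index_enum => /(_ isT).
by rewrite /= mulf_eq0 conjc_eq0 orbb => /eqP.
Qed.

Lemma conj_i : conjc ('i%C : C) = - 'i%C.
Proof. by apply/eqP; rewrite eq_complex /= oppr0 !eqxx. Qed.

Lemma mulii : 'i%C * 'i%C = -1 :> C.
Proof. by rewrite -expr2 sqr_i. Qed.

Lemma polarize_1_i (x y : C) : x + y = 0 -> - 'i%C * x + 'i%C * y = 0 -> x = 0.
Proof.
move=> H1 Hi; have /eqP : x *+ 2 = 0.
  transitivity (x + y + 'i%C * (- 'i%C * x + 'i%C * y)); last first.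
    by rewrite H1 Hi mulr0 addr0.
  by rewrite mulrDr !mulrA mulrN mulii mulNr; ring.
by rewrite mulrn_eq0 => /eqP.
Qed.

(** Polarization: testing the coefficient u on 1 and on the imaginary unit
    separates its linear and antilinear parts. *)
Lemma polarize (x y : C) : (forall u : C, conjc u * x + u * y = 0) -> x = 0.
Proof.
move=> H; apply: (@polarize_1_i x y).
  by have := H 1; rewrite conjc1 !mul1r.
by have := H 'i%C; rewrite conj_i.
Qed.

End Adjoint.

Section Classification.
Variables (R : realType) (n : nat).
Local Notation C := R[i].

Definition snoc r (e : 'I_r -> 'rV[C]_n) (v : 'rV[C]_n) : 'I_r.+1 -> 'rV[C]_n :=
  fun k => if unlift ord_max k is Some k' then e k' else v.

Definition unitary_family r (e : 'I_r -> 'rV[C]_n) :=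
  forall k l, sprod (e k) (e l) = (k == l)%:R.

(** The norm condition of a vector cross product in unitary coordinates, where
    the dual norm is the standard one; c is the square of the common length. *)
Definition vcp_on r (c : C) (b : {ffun 'I_r.+1 -> 'I_n} -> C) :=
  forall e, unitary_family e ->
    \sum_j form_eval b (snoc e (delta_mx 0 j))
           * conjc (form_eval b (snoc e (delta_mx 0 j))) = c.

(** Basis vectors indexed by natural numbers, so that the indices q, ..., q + 3
    can be used without bound proofs; out of range the vector is zero. *)
Definition dl (k : nat) : 'rV[C]_n := \row_j (j == k :> nat)%:R.

Lemma dl_delta (k : 'I_n) : dl k = delta_mx 0 k.
Proof. by apply/rowP => j; rewrite !mxE eqxx (inj_eq val_inj). Qed.

Lemma sprod_dlr (u : 'rV[C]_n) (k : 'I_n) : sprod u (dl k) = u 0 k.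
Proof.
rewrite sprodE (bigD1 k) //= mxE eqxx conjc1 mulr1 big1 ?addr0 // => j jk.
by rewrite mxE (inj_eq val_inj) (negPf jk) conjc0 mulr0.
Qed.

Lemma sprod_dl k l : (k < n)%N -> sprod (dl k) (dl l) = (k == l)%:R.
Proof.
move=> kn; rewrite (_ : k = Ordinal kn :> nat) // sprodC sprod_dlr mxE.
by rewrite conjc_nat.
Qed.

(** With n slots filled by a basis, the last argument repeats one of them. *)
Lemma vcp_top_degree c b : @vcp_on n c b -> alternating_form b -> c = 0.
Proof.
move=> vcp alt; rewrite -(vcp (fun k => dl k)); last first.
  by move=> k l; rewrite sprod_dl.
rewrite big1 // => j _.
rewrite (@form_eval_repeat _ _ _ b _ (lift ord_max j) ord_max) ?mul0r //.
  by rewrite eq_sym neq_lift.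
by rewrite /snoc liftK unlift_none dl_delta.
Qed.

End Classification.

(** ** Intermediate degrees *)

(** Filling q of the slots with basis vectors leaves an alternating trilinear
    form t on a space U of dimension at least four, with |t (x, y, -)|^2 = c
    |x|^2 |y|^2 for orthogonal x, y. Over the complex numbers this polarizes
    completely: the covectors t (x, y, -) are orthogonal for orthogonal planes.
    Hence, for p1, p2 in a basis and p0 any other basis vector, the covector t
    (p1, p2, -) is orthogonal to all t (p0, j, -), which already span the
    complement of p0; so it is a multiple of p0. Dimension four leaves two
    choices of p0, and t (p1, p2, -) = 0 contradicts c != 0. *)
Section MiddleDegree.
Variables (R : realType) (n q : nat) (c : R[i]).
Local Notation C := R[i].
Hypothesis qn : (q + 4 <= n)%N.
Variable b : {ffun 'I_q.+3 -> 'I_n} -> C.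
Hypotheses (alt : alternating_form b) (vcp : vcp_on c b).

Let args (x y w : 'rV[C]_n) : 'I_q.+3 -> 'rV[C]_n := fun k =>
  if (k < q)%N then dl R n k else
  if k == q :> nat then x else if k == q.+1 :> nat then y else w.
Let t x y w : C := form_eval b (args x y w).

Let ix : 'I_q.+3 := inord q.
Let iy : 'I_q.+3 := inord q.+1.
Let iw : 'I_q.+3 := inord q.+2.
Let ixE : ix = q :> nat. Proof. by rewrite inordK // ltnW. Qed.
Let iyE : iy = q.+1 :> nat. Proof. by rewrite inordK. Qed.
Let iwE : iw = q.+2 :> nat. Proof. by rewrite inordK. Qed.

Let args_x x y w : args x y w ix = x.
Proof. by rewrite /args ixE ltnn eqxx. Qed.
Let args_y x y w : args x y w iy = y.
Proof. by rewrite /args iyE ltnNge leqnSn /= gtn_eqF ?eqxx. Qed.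
Let args_w x y w : args x y w iw = w.
Proof.
by rewrite /args iwE ltnNge (leq_trans (leqnSn q)) //= !gtn_eqF.
Qed.

Let args_updx x y w : args x y w =1 upd (args 0 y w) ix x.
Proof.
move=> k; rewrite /upd; case: eqP => [->|/eqP]; first exact: args_x.
rewrite -(inj_eq val_inj) /= ixE => /negPf kq.
by rewrite /args kq.
Qed.

Let args_updy x y w : args x y w =1 upd (args x 0 w) iy y.
Proof.
move=> k; rewrite /upd; case: eqP => [->|/eqP]; first exact: args_y.
rewrite -(inj_eq val_inj) /= iyE => /negPf kq.
by rewrite /args kq.
Qed.

Let tDx x x' y w : t (x + x') y w = t x y w + t x' y w.
Proof. by rewrite /t !(form_eval_eq _ (args_updx _ y w)) form_eval_updD. Qed.

Let tZx u x y w : t (u *: x) y w = u * t x y w.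
Proof. by rewrite /t !(form_eval_eq _ (args_updx _ y w)) form_eval_updZ. Qed.

Let tDy x y y' w : t x (y + y') w = t x y w + t x y' w.
Proof. by rewrite /t !(form_eval_eq _ (args_updy x _ w)) form_eval_updD. Qed.

Let tZy u x y w : t x (u *: y) w = u * t x y w.
Proof. by rewrite /t !(form_eval_eq _ (args_updy x _ w)) form_eval_updZ. Qed.

Let neq_nat (k l : 'I_q.+3) : k != l :> nat -> k != l.
Proof. by apply: contraNneq => ->. Qed.

Let txx x w : t x x w = 0.
Proof.
apply: (@form_eval_repeat _ _ _ b _ ix iy) => //; last by rewrite args_x args_y.
by apply: neq_nat; rewrite ixE iyE ltn_eqF.
Qed.

Let txw x y : t x y x = 0.
Proof.
apply: (@form_eval_repeat _ _ _ b _ ix iw) => //; last by rewrite args_x args_w.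
by apply: neq_nat; rewrite ixE iwE ltn_eqF // ltnW.
Qed.

Let tC x y w : t x y w = - t y x w.
Proof.
apply/eqP; rewrite -addr_eq0; apply/eqP.
by have := txx (x + y) w; rewrite tDx !tDy !txx add0r addr0.
Qed.

Let tdl x y (k : nat) : (k < q)%N -> t x y (dl R n k) = 0.
Proof.
move=> kq; pose k' : 'I_q.+3 := inord k.
have k'E : k' = k :> nat by rewrite inordK // ltnW // ltnW // ltnW.
apply: (@form_eval_repeat _ _ _ b _ k' iw) => //.
  by apply: neq_nat; rewrite k'E iwE ltn_eqF // ltnW // ltnW.
by rewrite args_w /args k'E kq.
Qed.

(* The first q slots are filled with basis vectors; only vectors orthogonal to
   these complete them to orthonormal families. *)
Let inU (x : 'rV[C]_n) := forall k : 'I_n, (k < q)%N -> x 0 k = 0.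

Let inUD x y : inU x -> inU y -> inU (x + y).
Proof. by move=> Ux Uy k kq; rewrite mxE Ux // Uy // addr0. Qed.
Let inUZ u x : inU x -> inU (u *: x).
Proof. by move=> Ux k kq; rewrite mxE Ux // mulr0. Qed.
Let inU_dl k : (q <= k)%N -> inU (dl R n k).
Proof. by move=> qk l lq; rewrite mxE ltn_eqF // (leq_trans lq). Qed.

Let S x y x' y' : C := \sum_(k : 'I_n) t x y (dl R n k) * conjc (t x' y' (dl R n k)).

Let SDx x1 x2 y x' y' : S (x1 + x2) y x' y' = S x1 y x' y' + S x2 y x' y'.
Proof.
by rewrite /S -big_split; apply: eq_bigr => k _; rewrite tDx mulrDl.
Qed.
Let SDx' x1 x2 y x' y' : S x' y' (x1 + x2) y = S x' y' x1 y + S x' y' x2 y.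
Proof.
by rewrite /S -big_split; apply: eq_bigr => k _; rewrite tDx conjcD mulrDr.
Qed.
Let SDy y1 y2 x x' y' : S x (y1 + y2) x' y' = S x y1 x' y' + S x y2 x' y'.
Proof.
by rewrite /S -big_split; apply: eq_bigr => k _; rewrite tDy mulrDl.
Qed.
Let SDy' y1 y2 x x' y' : S x' y' x (y1 + y2) = S x' y' x y1 + S x' y' x y2.
Proof.
by rewrite /S -big_split; apply: eq_bigr => k _; rewrite tDy conjcD mulrDr.
Qed.
Let SZx u x y x' y' : S (u *: x) y x' y' = u * S x y x' y'.
Proof. by rewrite /S mulr_sumr; apply: eq_bigr => k _; rewrite tZx mulrA. Qed.
Let SZy u x y x' y' : S x (u *: y) x' y' = u * S x y x' y'.
Proof. by rewrite /S mulr_sumr; apply: eq_bigr => k _; rewrite tZy mulrA. Qed.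
Let SZx' u x y x' y' : S x' y' (u *: x) y = conjc u * S x' y' x y.
Proof.
by rewrite /S mulr_sumr; apply: eq_bigr => k _; rewrite tZx conjcM mulrCA.
Qed.
Let SZy' u x y x' y' : S x' y' x (u *: y) = conjc u * S x' y' x y.
Proof.
by rewrite /S mulr_sumr; apply: eq_bigr => k _; rewrite tZy conjcM mulrCA.
Qed.

Let nrm (x : 'rV[C]_n) : exists2 u : C, u * conjc u = sprod x x & u = 0 -> x = 0.
Proof.
exists (sqrtc (sprod x x)).
  have s0 : 0 <= sqrtc (sprod x x) by rewrite sqrtc_ge0 sprod_ge0.
  by rewrite -sqr_normc ger0_norm // sqr_sqrtc.
by move/eqP; rewrite sqrtc_eq0 => /eqP; exact: sprod_eq0.
Qed.

Let S_unit x y : inU x -> inU y -> sprod x x = 1 -> sprod y y = 1 ->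
  sprod x y = 0 -> S x y x y = c.
Proof.
move=> Ux Uy x1 y1 xy.
have yx : sprod y x = 0 by rewrite sprodC xy conjc0.
have xd k : (k < q)%N -> sprod x (dl R n k) = 0.
  move=> kq; have kn : (k < n)%N.
    by apply: leq_trans qn; rewrite ltn_addr.
  by rewrite (_ : k = Ordinal kn :> nat) // sprod_dlr Ux.
have yd k : (k < q)%N -> sprod y (dl R n k) = 0.
  move=> kq; have kn : (k < n)%N.
    by apply: leq_trans qn; rewrite ltn_addr.
  by rewrite (_ : k = Ordinal kn :> nat) // sprod_dlr Uy.
pose e (k : 'I_q.+2) := if (k < q)%N then dl R n k else
  if k == q :> nat then x else y.
have eP (k : 'I_q.+2) : [\/ (k < q)%N /\ e k = dl R n k,
    k = q :> nat /\ e k = x | k = q.+1 :> nat /\ e k = y].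
  rewrite /e; case: (ltngtP k q) => [kq|qk|kq]; [by constructor 1| |by constructor 2].
  by constructor 3; split=> //; apply/eqP; rewrite eqn_leq -ltnS ltn_ord.
have kn k : (k < q)%N -> (k < n)%N.
  by move=> kq; apply: leq_trans qn; rewrite ltn_addr.
have ortho : unitary_family e.
  move=> k l; rewrite -(inj_eq val_inj) /=.
  case: (eP k) => [[kq ->]|[-> ->]|[-> ->]];
  case: (eP l) => [[lq ->]|[-> ->]|[-> ->]].
  - by rewrite sprod_dl ?kn.
  - by rewrite sprodC xd // conjc0 ltn_eqF.
  - by rewrite sprodC yd // conjc0 ltn_eqF // ltnW.
  - by rewrite xd // gtn_eqF.
  - by rewrite x1 eqxx.
  - by rewrite xy ltn_eqF.
  - by rewrite yd // gtn_eqF // ltnW.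
  - by rewrite yx gtn_eqF.
  - by rewrite y1 eqxx.
rewrite -(vcp ortho); apply: eq_bigr => j _.
suff -> : t x y (dl R n j) = form_eval b (snoc e (delta_mx 0 j)) by [].
apply: form_eval_eq => k; rewrite /snoc /args -dl_delta.
case: unliftP => [k'|] ->; last first.
  by rewrite /= ltnNge (leq_trans (leqnSn q)) //= !gtn_eqF.
rewrite lift_max /e; case: ltnP => // qk; case: eqP => // /eqP kq.
rewrite ifT // eqn_leq -ltnS ltn_ord /=.
by rewrite ltn_neqAle eq_sym kq.
Qed.

Let S_scaled x y : inU x -> inU y -> sprod x y = 0 ->
  S x y x y = c * sprod x x * sprod y y.
Proof.
move=> Ux Uy xy; have [u uu u0] := nrm x; have [v vv v0] := nrm y.
have [/u0 ->|un] := eqVneq u 0.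
  rewrite sprod0l mulr0 mul0r /S big1 // => k _.
  by rewrite -(scale0r x) tZx !mul0r.
have [/v0 ->|vn] := eqVneq v 0.
  rewrite sprod0l mulr0 /S big1 // => k _.
  by rewrite -(scale0r x) tZy !mul0r.
have cu : conjc u != 0 by rewrite conjc_eq0.
have cv : conjc v != 0 by rewrite conjc_eq0.
have := @S_unit (u^-1 *: x) (v^-1 *: y) (inUZ _ Ux) (inUZ _ Uy).
rewrite !sprodZl !sprodZr -uu -vv xy !mulr0 !conjc_inv.
move=> /(_ _ _ erefl) <-; rewrite ?SZx ?SZx' ?SZy ?SZy' ?conjc_inv.
- by field; rewrite un vn cu cv.
- by field; rewrite un cu.
- by field; rewrite vn cv.
Qed.

(* The scaled identity for the pair (x, y + u y') has no cross terms. *)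
Let S_polar x y y' : inU x -> inU y -> inU y' ->
  sprod x y = 0 -> sprod x y' = 0 -> sprod y y' = 0 -> S x y x y' = 0.
Proof.
move=> Ux Uy Uy' xy xy' yy'.
apply: (@polarize _ _ (S x y' x y)) => u.
have y'y : sprod y' y = 0 by rewrite sprodC yy' conjc0.
have := @S_scaled x (y + u *: y') Ux (inUD Uy (inUZ _ Uy')).
rewrite sprodDr sprodZr xy xy' mulr0 addr0 => /(_ erefl).
rewrite SDy !SDy' !SZy !SZy' !S_scaled //.
rewrite sprodDl !sprodDr !sprodZl !sprodZr yy' y'y => H.
apply: (@addrI _ (c * sprod x x * (sprod y y + u * conjc u * sprod y' y'))).
rewrite addr0; move: H; set s1 := S x y x y'; set s2 := S x y' x y => H.
transitivity (c * sprod x x * sprod y y + conjc u * s1 +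
  (u * s2 + u * (conjc u * (c * sprod x x * sprod y' y')))); first by ring.
by rewrite H; ring.
Qed.

(* Polarization in the other argument: x + u x' is orthogonal to y and y'. *)
Let S_polar2 x x' y y' : inU x -> inU x' -> inU y -> inU y' ->
  sprod x x' = 0 -> sprod x y = 0 -> sprod x y' = 0 -> sprod x' y = 0 ->
  sprod x' y' = 0 -> sprod y y' = 0 -> S x y x' y' = 0.
Proof.
move=> Ux Ux' Uy Uy' xx' xy xy' x'y x'y' yy'.
apply: (@polarize _ _ (S x' y x y')) => u.
have := @S_polar (x + u *: x') y y' (inUD Ux (inUZ _ Ux')) Uy Uy'.
rewrite !sprodDl !sprodZl xy xy' x'y x'y' yy' mulr0 addr0.
move=> /(_ erefl erefl erefl) <-.
rewrite SDx !SDx' !SZx !SZx'.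
by rewrite (S_polar Ux Uy Uy') // (S_polar Ux' Uy Uy') // !mulr0 add0r addr0.
Qed.

Hypothesis c0 : c != 0.

Let t_only (p0 p1 p2 k : 'I_n) : (q <= p0)%N -> (q <= p1)%N -> (q <= p2)%N ->
  p0 != p1 -> p0 != p2 -> p1 != p2 -> k != p0 ->
  t (dl R n p1) (dl R n p2) (dl R n k) = 0.
Proof.
move=> q0 q1 q2 p01 p02 p12 kp0.
have D (i j : 'I_n) : sprod (dl R n i) (dl R n j) = (i == j)%:R.
  by rewrite sprod_dl.
have D0 (i j : 'I_n) : i != j -> sprod (dl R n i) (dl R n j) = 0.
  by move=> /negPf ij; rewrite D ij.
have [[U0 U1] U2] := (inU_dl q0, inU_dl q1, inU_dl q2).
have [p10 p20] : p1 != p0 /\ p2 != p0 by split; rewrite eq_sym.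
have p21 : p2 != p1 by rewrite eq_sym.
have orth (j : 'I_n) : (q <= j)%N -> j != p0 ->
    S (dl R n p1) (dl R n p2) (dl R n p0) (dl R n j) = 0.
  move=> qj jp0; have Uj := inU_dl qj; have [->|jp1] := eqVneq j p1.
    rewrite /S; under eq_bigr => l _ do rewrite [t (dl R n p0) _ _]tC rmorphN mulrN.
    by rewrite sumrN [X in - X]S_polar ?oppr0 ?D0.
  have [->|jp2] := eqVneq j p2.
    rewrite /S; under eq_bigr => l _ do
      rewrite [t (dl R n p0) _ _]tC [t (dl R n p1) _ _]tC rmorphN mulrNN.
    by rewrite [LHS]S_polar ?D0.
  by rewrite S_polar2 ?D0 // eq_sym.
(* The rows of X are the covectors t (p0, j, -), completed by the basis vectors
   in the directions that these cannot reach. *)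
pose unused j := (j < q)%N || (j == p0 :> nat).
pose X : 'M[C]_n := \matrix_(j, l) if unused j then (l == j)%:R else
  t (dl R n p0) (dl R n j) (dl R n l).
pose d : 'rV[C]_n := \row_j if unused j then 1 else c.
have Xun j l : unused j -> unused l = false ->
    t (dl R n p0) (dl R n l) (dl R n j) = 0.
  by rewrite /unused => /orP[jq _|/eqP -> _]; [exact: tdl | exact: txw].
have XX : X *m adjmx X = diag_mx d.
  apply/matrixP => i j; rewrite !mxE.
  under eq_bigr => l _ do rewrite adjmxE !mxE.
  case ui : (unused i).
    rewrite (bigD1 i) //= eqxx mul1r [X in _ + X]big1 ?addr0 => [|l /negPf ->];
      last by rewrite mul0r.
    case uj : (unused j); last first.
      rewrite Xun // conjc0; case: eqP => // ij.
      by move: ui; rewrite ij uj.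
    by rewrite conjc_nat; case: eqP.
  case uj : (unused j).
    rewrite (bigD1 j) //= eqxx conjc1 mulr1 [X in _ + X]big1 ?addr0;
      last by move=> l /negPf ->; rewrite conjc0 mulr0.
    rewrite Xun //; case: eqP => // ij.
    by move: ui; rewrite ij uj.
  have [qi ip] : (q <= i)%N /\ i != p0.
    by move: ui; rewrite /unused; case: ltnP => //= ? /negbT; rewrite (inj_eq val_inj).
  have [qj jp] : (q <= j)%N /\ j != p0.
    by move: uj; rewrite /unused; case: ltnP => //= ? /negbT; rewrite (inj_eq val_inj).
  have [<-|ij] := eqVneq i j.
    rewrite mulr1n [LHS]S_scaled //; first by rewrite !D !eqxx !mulr1.
      exact: inU_dl.
    by rewrite D0 // eq_sym.
  rewrite mulr0n [LHS]S_polar ?D0 //; first [exact: inU_dl | by rewrite eq_sym].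
have Xu : adjmx X \in unitmx.
  have : \det (X *m adjmx X) != 0.
    rewrite XX det_diag; apply/prodf_neq0 => j _; rewrite mxE.
    by case: ifP => _; rewrite ?oner_eq0.
  by rewrite det_mulmx mulf_eq0 negb_or unitmxE unitfE => /andP[].
pose v : 'rV[C]_n := \row_l t (dl R n p1) (dl R n p2) (dl R n l).
have vE : v = v 0 p0 *: delta_mx 0 p0.
  apply: (can_inj (mulmxK Xu)); apply/rowP => j; rewrite -scalemxAl -rowE !mxE.
  under eq_bigr => l _ do rewrite adjmxE !mxE.
  case uj : (unused j).
    rewrite (bigD1 j) //= eqxx conjc1 mulr1 [X in _ + X]big1 ?addr0;
      last by move=> l /negPf ->; rewrite conjc0 mulr0.
    case: eqP => [->|/eqP pj]; first by rewrite conjc1 mulr1.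
    rewrite conjc0 mulr0 tdl //; move: uj; rewrite /unused => /orP[//|].
    by rewrite (inj_eq val_inj) eq_sym (negPf pj).
  rewrite txw conjc0 mulr0.
  have [qj jp] : (q <= j)%N /\ j != p0.
    by move: uj; rewrite /unused; case: ltnP => //= ? /negbT; rewrite (inj_eq val_inj).
  exact: orth.
have := congr1 (fun w : 'rV[C]_n => w 0 k) vE.
by rewrite !mxE (negPf kp0) andbF mulr0.
Qed.

Lemma middle_degree_absurd : False.
Proof.
have lt k : (k < 4)%N -> (q + k < n)%N.
  by move=> k4; apply: leq_trans qn; rewrite ltn_add2l.
pose p k (k4 : (k < 4)%N) : 'I_n := Ordinal (lt k k4).
pose p0 := p 0%N isT; pose p1 := p 1%N isT; pose p2 := p 2%N isT.
pose p3 := p 3%N isT.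
have qp k k4 : (q <= @p k k4)%N by rewrite leq_addr.
have np k k4 l l4 : k != l -> @p k k4 != @p l l4.
  by rewrite -(inj_eq val_inj) /= eqn_add2l.
have t0 (k : 'I_n) : t (dl R n p1) (dl R n p2) (dl R n k) = 0.
  have [->|k0] := eqVneq k p0; last by apply: (@t_only p0) => //; first [exact: qp | exact: np].
  by apply: (@t_only p3) => //; first [exact: qp | exact: np].
have := @S_scaled (dl R n p1) (dl R n p2) (inU_dl (qp _ _)) (inU_dl (qp _ _)).
rewrite !sprod_dl ?ltn_ord // !eqxx (inj_eq val_inj) (negPf (np _ _ _ _ _)) //.
rewrite !mulr1 => /(_ erefl) cE; move: c0; rewrite -cE /S big1 ?eqxx // => k _.
by rewrite t0 mul0r.
Qed.

End MiddleDegree.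

(** * The complex structure and a Hermitian metric on one tangent space *)

Section ComplexStructure.
Variables (R : realType) (n : nat).
Local Notation C := R[i].
Local Notation N := (n + n)%N.
Local Notation toC := (map_mx (real_complex R)).
Local Notation J := (std_J R n).

Lemma std_JJ : J *m J = - 1%:M.
Proof.
rewrite /std_J mulmx_block !mul0mx !mulmx0 !mul1mx !mulmx1 !add0r !addr0.
by rewrite (scalar_mx_block n n) opp_block_mx !oppr0.
Qed.

Lemma std_J_tr : J^T = - J.
Proof.
by rewrite /std_J tr_block_mx opp_block_mx !trmx0 linearN /= trmx1 opprK oppr0.
Qed.

(** The rows of W0 are the vectors 2 d/dz_j, which span T^{1,0}; the columns of
    Z0 are the covectors dz_j, whose common kernel is T^{0,1}. *)
Definition W0 : 'M[C]_(n, N) := row_mx 1%:M (- 'i%C)%:M.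
Definition Z0 : 'M[C]_(N, n) := col_mx 1%:M ('i%C)%:M.

Lemma adjmx_scalar m (c : C) : adjmx (c%:M : 'M[C]_m) = (conjc c)%:M.
Proof. by rewrite /adjmx map_scalar_mx tr_scalar_mx. Qed.

Lemma adj_W0 : adjmx W0 = Z0.
Proof. by rewrite adjmx_row_mx adjmx1 adjmx_scalar conjcN conj_i opprK. Qed.

Lemma adj_Z0 : adjmx Z0 = W0.
Proof. by rewrite -adj_W0 adjmxK. Qed.

Lemma W0_Z0 : W0 *m Z0 = 2%:M.
Proof.
rewrite mul_row_col mul1mx -scalar_mxM mulNr mulii opprK -raddfD /=.
by rewrite -mulr2n.
Qed.

Lemma toC_J : toC J = block_mx 0 1%:M (- 1%:M) 0.
Proof. by rewrite /std_J map_block_mx map_mx0 map_mx1 map_mxN map_mx1. Qed.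

Lemma mul_row_toCJ m (x y : 'M[C]_(m, n)) :
  row_mx x y *m toC J = row_mx (- y) x.
Proof.
by rewrite toC_J mul_row_block !mulmx0 add0r addr0 mulmx1 mulmxN mulmx1.
Qed.

Lemma mul_toCJ_col m (x y : 'M[C]_(n, m)) :
  toC J *m col_mx x y = col_mx y (- x).
Proof.
by rewrite toC_J mul_block_col !mul0mx add0r addr0 mul1mx mulNmx mul1mx.
Qed.

Lemma type10_row m (B : 'M[C]_(m, N)) :
  B *m toC J = 'i%C *: B -> B = lsubmx B *m W0.
Proof.
rewrite -[in X in X -> _](hsubmxK B) mul_row_toCJ scale_row_mx => /eq_row_mx [E _].
rewrite mul_mx_row mulmx1 mul_mx_scalar -[LHS]hsubmxK; congr row_mx.
by rewrite scaleNr -E opprK.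
Qed.

Lemma type10_col m (B : 'M[C]_(N, m)) :
  toC J *m B = 'i%C *: B -> B = Z0 *m usubmx B.
Proof.
rewrite -[in X in X -> _](vsubmxK B) mul_toCJ_col scale_col_mx => /eq_col_mx [E _].
by rewrite mul_col_mx mul1mx mul_scalar_mx -E vsubmxK.
Qed.

Lemma W0_J : W0 *m toC J = 'i%C *: W0.
Proof.
rewrite mul_row_toCJ scale_row_mx; congr row_mx.
  by rewrite scale_scalar_mx mulr1 -raddfN /= opprK.
by rewrite scale_scalar_mx mulrN mulii opprK.
Qed.

Lemma J_Z0 : toC J *m Z0 = 'i%C *: Z0.
Proof.
rewrite mul_toCJ_col scale_col_mx; congr col_mx.
  by rewrite scale_scalar_mx mulr1.
by rewrite scale_scalar_mx mulii raddfN.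
Qed.

Lemma in_T10_W0 (u : 'rV[C]_n) : in_T10 (u *m W0).
Proof. by rewrite /in_T10 -mulmxA W0_J -scalemxAr. Qed.

Lemma in_T01_Z0 (e : 'rV[C]_N) : e *m Z0 = 0 -> in_T01 e.
Proof.
rewrite -(hsubmxK e) mul_row_col mulmx1 mul_mx_scalar => /eqP.
rewrite addr_eq0 => /eqP ->; rewrite /in_T01 mul_row_toCJ scale_row_mx.
by rewrite scalerN scalerA mulNr mulii opprK scale1r scaleNr.
Qed.

Lemma Z0_W0 : Z0 *m W0 = 1%:M - 'i%C *: toC J.
Proof.
rewrite mul_col_row !mul1mx mulmx1 -scalar_mxM mulrN mulii opprK toC_J.
rewrite scale_block_mx opp_block_mx (scalar_mx_block n n 1) add_block_mx.
rewrite !scaler0 !oppr0 !addr0 !add0r scalerN opprK !scale_scalar_mx mulr1.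
by rewrite raddfN.
Qed.

(** A real endomorphism commuting with the complex structure is the complex
    endomorphism with this matrix. *)
Definition cpx (B : 'M[R]_N) : 'M[C]_n := 2^-1 *: (W0 *m toC B *m Z0).

Lemma two_neq0 : (2 : C) != 0. Proof. by rewrite pnatr_eq0. Qed.

Lemma half_two m k (B : 'M[C]_(m, k)) : 2^-1 *: (2 *: B) = B.
Proof. by rewrite scalerA mulVf ?two_neq0 // scale1r. Qed.

Lemma mul_Z0_cpx (B : 'M[R]_N) : B *m J = J *m B -> toC B *m Z0 = Z0 *m cpx B.
Proof.
move=> BJ; set X := toC B *m Z0.
have XE : X = Z0 *m usubmx X.
  by apply: type10_col; rewrite mulmxA -map_mxM -BJ map_mxM -mulmxA J_Z0 -scalemxAr.
suff -> : cpx B = usubmx X by [].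
by rewrite /cpx -mulmxA -/X XE mulmxA W0_Z0 mul_scalar_mx half_two -XE.
Qed.

Lemma mul_W0_cpx (B : 'M[R]_N) : B *m J = J *m B -> W0 *m toC B = cpx B *m W0.
Proof.
move=> BJ; set X := W0 *m toC B.
have XE : X = lsubmx X *m W0.
  by apply: type10_row; rewrite -mulmxA -map_mxM BJ map_mxM mulmxA W0_J -scalemxAl.
suff -> : cpx B = lsubmx X by [].
by rewrite /cpx -/X [in LHS]XE -mulmxA W0_Z0 mul_mx_scalar half_two.
Qed.

End ComplexStructure.

Section HermitianPoint.
Variables (R : realType) (n : nat).
Local Notation C := R[i].
Local Notation N := (n + n)%N.
Local Notation toC := (map_mx (real_complex R)).
Local Notation J := (std_J R n).
Local Notation W0 := (W0 R n).
Local Notation Z0 := (Z0 R n).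
Variable G : 'M[R]_N.
Hypothesis Gsym : G^T = G.
Hypothesis GJ : J *m G *m J^T = G.
Hypothesis Gpos : forall v : 'rV[R]_N, v != 0 -> 0 < (v *m G *m v^T) 0 0.

Lemma metric_J_comm : G *m J = J *m G.
Proof.
rewrite -[in LHS]GJ -!mulmxA std_J_tr mulNmx std_JJ opprK.
by rewrite mulmx1.
Qed.

Lemma metric_unit : G \in unitmx.
Proof.
rewrite -row_free_unit -kermx_eq0; apply/rowV0P => v /sub_kermxP vG.
apply/eqP/negP => /negP /Gpos; by rewrite vG mul0mx mxE ltxx.
Qed.

Lemma inv_metric_J_comm : invmx G *m J = J *m invmx G.
Proof.
apply: (can_inj (mulKmx metric_unit)); rewrite mulKVmx ?metric_unit //.
by rewrite mulmxA metric_J_comm mulmxK ?metric_unit.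
Qed.

(** For e = x + i y the value is g(x, x) + g(y, y); the imaginary part cancels
    by symmetry. *)
Lemma herm_dot_pos (e : 'rV[C]_N) : e != 0 -> 0 < herm_dot G e e.
Proof.
move=> e0; pose x := map_mx (@complex.Re R) e; pose y := map_mx (@complex.Im R) e.
have eE : e = toC x + 'i%C *: toC y.
  by apply/matrixP => i j; rewrite !mxE -complexE.
have -> : herm_dot G e e = ((x *m G *m x^T) 0 0 + (y *m G *m y^T) 0 0)%:C.
  have entry (u v : 'rV[R]_N) :
      (toC u *m toC G *m toC v^T) 0 0 = ((u *m G *m v^T) 0 0)%:C.
    by rewrite -!map_mxM mxE.
  have quad (s u : C) (A B D F : 'M[C]_1) :
      (A + s *: B + u *: (D + s *: F)) 0 0
      = A 0 0 + s * B 0 0 + u * (D 0 0 + s * F 0 0) by rewrite !mxE.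
  have yx : (y *m G *m x^T) 0 0 = (x *m G *m y^T) 0 0.
    rewrite -[in LHS](trmxK (y *m G *m x^T)) [LHS]mxE.
    by rewrite !trmx_mul !trmxK Gsym mulmxA.
  rewrite /herm_dot -/(adjmx e) eE adjmxD adjmxZ !adjmx_real conj_i.
  rewrite mulmxDl -scalemxAl mulmxDl -scalemxAl !mulmxDr -!scalemxAr.
  rewrite quad 4!entry yx rmorphD /=.
  by rewrite mulrDr mulrA mulrN mulii opprK mul1r; ring.
rewrite (ltcR 0); have [x0|x0] := eqVneq x 0.
  rewrite x0 mul0mx mul0mx mxE add0r; apply: Gpos; apply: contraNneq e0 => y0.
  by rewrite eE x0 y0 !map_mx0 scaler0 addr0.
apply: ltr_pwDl; first exact: Gpos.
have [->|/Gpos /ltW //] := eqVneq y 0.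
by rewrite !mul0mx mxE.
Qed.

(** The Gram matrix of the vectors 2 d/dz_j. *)
Definition herm : 'M[C]_n := W0 *m toC G *m Z0.

Lemma herm_adj : adjmx herm = herm.
Proof. by rewrite /herm !adjmxM adj_Z0 adj_W0 adjmx_real Gsym mulmxA. Qed.

Lemma herm_dot_W0 (u v : 'rV[C]_n) :
  herm_dot G (u *m W0) (v *m W0) = (u *m herm *m adjmx v) 0 0.
Proof. by rewrite /herm_dot -/(adjmx _) adjmxM adj_W0 /herm !mulmxA. Qed.

Lemma herm_pos (u : 'rV[C]_n) : u != 0 -> 0 < (u *m herm *m adjmx u) 0 0.
Proof.
move=> u0; rewrite -herm_dot_W0 herm_dot_pos //; apply: contraNneq u0 => uW.
by rewrite -(half_two u) -(mul_mx_scalar 2 u) -W0_Z0 mulmxA uW mul0mx scaler0.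
Qed.

(** Diagonalize the Hermitian matrix and rescale by the square roots of its
    positive eigenvalues. *)
Lemma unitary_frame : exists E : 'M[C]_n, E *m herm *m adjmx E = 1%:M.
Proof.
have nH : herm \is normalmx.
  apply/normalmxP; suff -> : map_mx Num.conj herm^T = herm by [].
  by rewrite -[RHS]herm_adj; apply/matrixP => i j; rewrite !mxE.
pose P := spectralmx herm; pose d := spectral_diag herm.
have PP : P *m adjmx P = 1%:M.
  have /unitarymxP <- := spectral_unitarymx herm.
  by congr (_ *m _); apply/matrixP => i j; rewrite !mxE.
have HE : P *m herm *m adjmx P = diag_mx d.
  have /orthomx_spectralP HE := nH.
  have Pu : P \in unitmx by exact: spectral_unit.
  by rewrite [in LHS]HE -/P -/d !mulmxA mulmxV // mul1mx -mulmxA PP mulmx1.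
have d0 k : 0 < d 0 k.
  have -> : d 0 k = (row k P *m herm *m adjmx (row k P)) 0 0.
    transitivity ((diag_mx d) k k); first by rewrite mxE eqxx mulr1n.
    rewrite -HE -row_mul !mxE; apply: eq_bigr => j _; congr (_ * _).
      by rewrite !mxE.
    by rewrite !adjmxE mxE.
  apply: herm_pos; apply/eqP => Pk; have := congr1 (fun B : 'M[C]_n => B k k) PP.
  rewrite !mxE eqxx => /eqP; rewrite big1 ?(eq_sym 0) ?oner_eq0 // => j _.
  by have := congr1 (fun B : 'rV[C]_n => B 0 j) Pk; rewrite !mxE => ->; rewrite mul0r.
pose s : 'rV[C]_n := \row_k (sqrtc (d 0 k))^-1.
exists (diag_mx s *m P).
have -> : diag_mx s *m P *m herm *m adjmx (diag_mx s *m P)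
    = diag_mx s *m diag_mx d *m adjmx (diag_mx s).
  by rewrite adjmxM -HE !mulmxA.
have -> : adjmx (diag_mx s) = diag_mx s.
  apply/matrixP => i j; rewrite adjmxE !mxE eq_sym; case: eqP => [->|_].
    rewrite !mulr1n; apply: CrealP; rewrite realV ger0_real //.
    by rewrite sqrtc_ge0 ltW.
  by rewrite !mulr0n conjc0.
rewrite !mulmx_diag -diag_const_mx; congr diag_mx; apply/rowP => k; rewrite !mxE.
have sk : sqrtc (d 0 k) != 0 by rewrite sqrtc_eq0 gt_eqF.
by rewrite -{2}(sqr_sqrtc (d 0 k)); field.
Qed.

Lemma frame_unitary (E : 'M[C]_n) : E *m herm *m adjmx E = 1%:M ->
  E *m W0 *m toC G *m adjmx (E *m W0) = 1%:M.
Proof. by move=> <-; rewrite adjmxM adj_W0 /herm !mulmxA. Qed.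

Lemma frame_type10 (E : 'M[C]_n) : E *m W0 *m toC J = 'i%C *: (E *m W0).
Proof. by rewrite -mulmxA W0_J -scalemxAr. Qed.

Section Frame.
Variable W : 'M[C]_(n, N).
Hypothesis GW : W *m toC G *m adjmx W = 1%:M.
Hypothesis WJ : W *m toC J = 'i%C *: W.

Lemma frame_orth (u v : 'rV[C]_n) : herm_dot G (u *m W) (v *m W) = sprod u v.
Proof.
rewrite /herm_dot -/(adjmx _) /sprod adjmxM !mulmxA -!(mulmxA u).
by rewrite GW mul1mx.
Qed.

(** In a unitary frame, the dual norm of a covector of type (1,0) is the sum of
    the squares of its values on the frame: the frame and its conjugate form an
    orthonormal basis of the complexified tangent space. *)
Lemma herm_dot_dual (alpha : 'rV[C]_N) : alpha *m adjmx W = 0 ->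
  herm_dot (invmx G) alpha alpha = sprod (alpha *m W^T) (alpha *m W^T).
Proof.
move=> aW; pose Wc := map_mx (@conjc R) W.
have WcT : adjmx W = Wc^T by [].
have WTc : adjmx Wc = W^T by apply/matrixP => i j; rewrite adjmxE !mxE conjcK.
have WWT : W *m toC G *m W^T = 0.
  have H : W *m toC G *m W^T = - (W *m toC G *m W^T).
    rewrite -[in LHS]GJ !map_mxM !mulmxA WJ -!mulmxA.
    have -> : toC J^T *m W^T = 'i%C *: W^T.
      by rewrite -map_trmx -trmx_mul WJ linearZ.
    by rewrite -!scalemxAr -scalemxAl scalerA mulii scaleN1r.
  apply/eqP; have := subrr (W *m toC G *m W^T); rewrite {2}H opprK -mulr2n.
  by move/eqP; rewrite -scaler_nat scaler_eq0 (negPf (two_neq0 R)).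
have WcG : Wc *m toC G *m adjmx W = 0.
  have := congr1 (map_mx (@conjc R)) WWT; rewrite !map_mxM map_mx0 => <-.
  congr (_ *m _ *m _); first by apply/matrixP => i j; rewrite !mxE; exact/esym/conjc_real.
  by rewrite /adjmx map_trmx.
have WcGT : Wc *m toC G *m W^T = 1%:M.
  have := congr1 (map_mx (@conjc R)) GW; rewrite !map_mxM map_mx1 => <-.
  congr (_ *m _ *m _); first by apply/matrixP => i j; rewrite !mxE; exact/esym/conjc_real.
  by apply/matrixP => i j; rewrite !mxE; exact/esym/conjcK.
pose F := col_mx W Wc.
have FF : (F *m toC G) *m row_mx (adjmx W) W^T = 1%:M.
  by rewrite mul_col_mx mul_col_row GW WWT WcG WcGT -scalar_mx_block.
have invG : toC (invmx G) = row_mx (adjmx W) W^T *m F.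
  move: FF; rewrite -mulmxA => /mulmx1C; rewrite -mulmxA => GX.
  have [uG _] := mulmx1_unit GX.
  by rewrite map_invmx -[RHS](mulKmx uG) GX mulmx1.
rewrite /herm_dot -/(adjmx alpha) invG mul_row_col mulmxDr mulmxDl.
by rewrite mulmxA aW !mul0mx add0r /sprod adjmxM -WTc adjmxK !mulmxA.
Qed.

End Frame.

Section FormPoint.
Variable p : nat.
Variable a : {ffun 'I_p -> 'I_N} -> C.
Hypothesis a10 : forall (e : 'I_p -> 'rV[C]_N) k, in_T01 (e k) ->
  form_eval a e = 0.

(** A vector v and the vector with components (v *m Z0, 0) have the same values
    under all dz_j, hence differ by a vector of type (0,1). *)
Lemma form_eval_dz (e : 'I_p -> 'rV[C]_N) :
  form_eval a e = form_eval a (fun k => row_mx (e k *m Z0) 0).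
Proof.
apply: (@form_eval_congr _ _ _ a (@in_T01 R n)) => [f k|k]; first exact: a10.
apply: in_T01_Z0; rewrite mulmxBl mul_row_col mulmx1 mul0mx addr0.
exact: subrr.
Qed.

End FormPoint.

Section LastSlot.
Variables (m r : nat) (a : {ffun 'I_r.+1 -> 'I_m} -> C) (e : 'I_r -> 'rV[C]_m).

Lemma snoc_upd v : snoc e v =1 upd (snoc e 0) ord_max v.
Proof.
move=> k; rewrite /snoc /upd; case: unliftP => [k'|] -> /=; last by rewrite eqxx.
by rewrite eq_sym (negPf (neq_lift _ _)).
Qed.

Lemma contract_mulmx q (B : 'M[C]_(m, q)) j :
  (Defs.contract a e *m B) 0 j = form_eval a (snoc e (col j B)^T).
Proof.
rewrite (form_eval_eq _ (snoc_upd _)) form_eval_updE mxE.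
under eq_bigr => l _ do
  rewrite mxE (form_eval_eq _ (snoc_upd _)) form_eval_updE mulr_suml.
rewrite exchange_big; apply: eq_bigr => i _ /=; rewrite (bigD1 (i ord_max)) //=.
rewrite [X in _ + X]big1 ?addr0 => [|l /negPf li]; last first.
  by rewrite mxE eq_sym li andbF mul0r mulr0 mul0r.
by rewrite !mxE !eqxx mul1r -mulrA [_ * B _ _]mulrC.
Qed.

End LastSlot.

Section VcpPoint.
Variables (r : nat) (a : {ffun 'I_r.+1 -> 'I_N} -> C).
Hypothesis a10 : forall (e : 'I_r.+1 -> 'rV[C]_N) k, in_T01 (e k) ->
  form_eval a e = 0.
Hypothesis avcp : forall e : 'I_r -> 'rV[C]_N, (forall k, in_T10 (e k)) ->
  (forall k l, herm_dot G (e k) (e l) = (k == l)%:R) ->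
  conorm G (Defs.contract a e) = Num.sqrt 2 ^+ r.+1.

(** The contraction is of type (1,0), and the conjugate of a (1,0)-frame is of
    type (0,1). *)
Lemma contract_frame (W : 'M[C]_(n, N)) (e : 'I_r -> 'rV[C]_N) :
  W *m toC J = 'i%C *: W -> Defs.contract a e *m adjmx W = 0.
Proof.
move=> WJ; apply/rowP => j; rewrite contract_mulmx mxE.
apply: (a10 (k := ord_max)).
rewrite /snoc unlift_none tr_col /adjmx trmxK /in_T01 -row_mul.
suff -> : map_mx (@conjc R) W *m toC J = - 'i%C *: map_mx (@conjc R) W.
  exact: linearZ.
transitivity (map_mx (@conjc R) (W *m toC J)).
  rewrite map_mxM; congr (_ *m _); apply/matrixP => k l; rewrite !mxE.
  exact/esym/conjc_real.
by rewrite WJ; apply/matrixP => k l; rewrite !mxE conjcM conj_i.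
Qed.

Lemma vcp_herm_dot (e : 'I_r -> 'rV[C]_N) : (forall k, in_T10 (e k)) ->
  (forall k l, herm_dot G (e k) (e l) = (k == l)%:R) ->
  herm_dot (invmx G) (Defs.contract a e) (Defs.contract a e) = 2 ^+ r.+1.
Proof.
move=> e10 eo; have [E /frame_unitary GW] := unitary_frame.
have WJ := frame_type10 E.
have := avcp e10 eo; rewrite /conorm (herm_dot_dual GW WJ (contract_frame e WJ)).
set h := sprod _ _ => hE; have h0 : 0 <= h by exact: sprod_ge0.
have := congr1 (fun x => x ^+ 2) hE; rewrite /= sqr_sqrtr; last first.
  by move: h0; rewrite lecE => /andP[].
rewrite exprAC sqr_sqrtr // => hR.
rewrite (complexE h) (ger0_Im h0) mulr0 addr0 hR.
by rewrite rmorphXn rmorph_nat.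
Qed.

Lemma vcp_pullback (W : 'M[C]_(n, N)) :
  W *m toC G *m adjmx W = 1%:M -> W *m toC J = 'i%C *: W ->
  vcp_on (2 ^+ r.+1) (pullback a W).
Proof.
move=> GW WJ u ou; pose e k := u k *m W.
have e10 k : in_T10 (e k) by rewrite /in_T10 -mulmxA WJ -scalemxAr.
have eo k l : herm_dot G (e k) (e l) = (k == l)%:R by rewrite frame_orth.
rewrite -(vcp_herm_dot e10 eo) (herm_dot_dual GW WJ (contract_frame e WJ)).
rewrite sprodE; apply: eq_bigr => j _.
suff -> : (Defs.contract a e *m W^T) 0 j
    = form_eval (pullback a W) (snoc u (delta_mx 0 j)) by [].
rewrite contract_mulmx form_eval_pullback; apply: form_eval_eq => k.
rewrite /snoc; case: unliftP => //= _.
by rewrite -rowE -tr_row trmxK.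
Qed.

End VcpPoint.
End HermitianPoint.

(** * The norm condition in top degree *)

Section TopPoint.
Variables (R : realType) (r : nat).
Local Notation C := R[i].
Local Notation n := r.+1.
Local Notation N := (n + n)%N.
Local Notation toC := (map_mx (real_complex R)).
Local Notation J := (std_J R n).
Local Notation W0 := (W0 R n).
Local Notation Z0 := (Z0 R n).
Variable a : {ffun 'I_n -> 'I_N} -> C.
Hypothesis a10 : forall (e : 'I_n -> 'rV[C]_N) k, in_T01 (e k) ->
  form_eval a e = 0.
Hypothesis alt : alternating_form a.

(** The coefficient of dz_1 ... dz_n, the left indices being those of d/dx_j. *)
Definition top_comp : C := a [ffun k => lshift n k].

Lemma form_eval_top10 (e : 'I_n -> 'rV[C]_N) (B : 'M[C]_n) :
  (forall k, e k *m Z0 = row k B) -> form_eval a e = \det B * top_comp.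
Proof.
move=> eB; pose L : 'M[C]_(n, N) := row_mx 1%:M 0.
rewrite (form_eval_dz a10).
transitivity (form_eval (pullback a L) (fun k => row k B)).
  rewrite form_eval_pullback; apply: form_eval_eq => k.
  by rewrite eB mul_mx_row mulmx1 mulmx0.
rewrite form_eval_top; last exact: pullback_alternating_form.
rewrite /pullback /top_comp -form_eval_delta; congr (_ * _).
apply: form_eval_eq => k; rewrite !ffunE.
by rewrite delta_mx_lshift row_row_mx row1 row0.
Qed.

(** The value of the form dz_1 ... dz_n on the coordinate fields of index i. *)
Definition dz_det (i : {ffun 'I_n -> 'I_N}) : C := \det (\matrix_(k, j) Z0 (i k) j).

Lemma top_components i : a i = dz_det i * top_comp.
Proof.
rewrite -[LHS]form_eval_delta; apply: form_eval_top10 => k.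
by rewrite -rowE; apply/rowP => j; rewrite !mxE.
Qed.

Variable G : 'M[R]_N.
Hypothesis Gsym : G^T = G.
Hypothesis GJ : J *m G *m J^T = G.
Hypothesis Gpos : forall v : 'rV[R]_N, v != 0 -> 0 < (v *m G *m v^T) 0 0.
Hypothesis avcp : forall e : 'I_r -> 'rV[C]_N, (forall k, in_T10 (e k)) ->
  (forall k l, herm_dot G (e k) (e l) = (k == l)%:R) ->
  conorm G (Defs.contract a e) = Num.sqrt 2 ^+ r.+1.

(** Only the last basis vector completes the first r ones, so the norm
    condition on one unitary frame is a condition on the top component. *)
Lemma top_norm : 2 ^+ n * (top_comp * conjc top_comp) = \det (herm G).
Proof.
have [E EH] := unitary_frame Gsym Gpos.
have vcp := vcp_pullback Gsym GJ Gpos a10 avcp (frame_unitary EH) (frame_type10 E).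
have bE : form_eval (pullback a (E *m W0)) (snoc (fun k : 'I_r => dl R n k) (delta_mx 0 ord_max))
    = 2 ^+ n * \det E * top_comp.
  rewrite form_eval_pullback.
  rewrite (@form_eval_top10 _ (2 *: E)); first by rewrite detZ.
  move=> k; rewrite -!mulmxA W0_Z0 mul_mx_scalar.
  have -> : snoc (fun k : 'I_r => dl R n k) (delta_mx 0 ord_max) k = delta_mx 0 k.
    rewrite /snoc; case: unliftP => [k'|] -> //.
    by rewrite -dl_delta lift_max.
  by rewrite -rowE.
have := vcp (fun k => dl R n k).
rewrite (bigD1 ord_max) //= [X in _ + X]big1 ?addr0 => [|j jm]; last first.
  have : ord_max != j by rewrite eq_sym.
  case/unlift_some => l jl _; rewrite form_eval_pullback.
  rewrite -form_eval_pullback (@form_eval_repeat _ _ _ _ _ j ord_max) ?mul0r //.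
    exact: pullback_alternating_form.
  by rewrite /snoc unlift_none jl liftK -dl_delta lift_max.
have ou : unitary_family (fun k : 'I_r => dl R n k).
  by move=> k l; rewrite sprod_dl // ltnW // ltnS.
move=> /(_ ou); rewrite bE => vE.
have := congr1 determinant EH; rewrite !det_mulmx det1 /adjmx det_tr det_map_mx /=.
set D := \det E in vE *; set h := \det _; set f := top_comp in vE * => hE.
have two : (2 ^+ n : C) != 0 by rewrite expf_neq0 // two_neq0.
have c2 : conjc (2 ^+ n : C) = 2 ^+ n by rewrite rmorphXn; congr (_ ^+ _); exact: conjc_nat.
have D0 : D * conjc D != 0.
  by apply: contra_eq_neq hE; rewrite mulrAC => ->; rewrite mul0r eq_sym oner_eq0.
apply: (mulfI D0); transitivity (1 : C); last by rewrite -hE mulrAC.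
apply: (mulfI two); rewrite mulr1 -[RHS]vE !conjcM c2; ring.
Qed.

End TopPoint.

(** * The norm condition in degree two *)
Section SymplecticPoint.
Variables (R : realType) (n : nat).
Local Notation C := R[i].
Local Notation N := (n + n)%N.
Local Notation toC := (map_mx (real_complex R)).
Local Notation J := (std_J R n).
Local Notation W0 := (W0 R n).
Local Notation Z0 := (Z0 R n).
Variable a : {ffun 'I_2 -> 'I_N} -> C.
Hypothesis a10 : forall (e : 'I_2 -> 'rV[C]_N) k, in_T01 (e k) ->
  form_eval a e = 0.
Hypothesis alt : alternating_form a.

Definition pair_index m (x y : 'I_m) : {ffun 'I_2 -> 'I_m} :=
  [ffun k => if k == ord0 then x else y].

Definition form_mx : 'M[C]_N := \matrix_(i, j) a (pair_index i j).
Definition form_re : 'M[R]_N := map_mx (@complex.Re R) form_mx.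
Definition form_im : 'M[R]_N := map_mx (@complex.Im R) form_mx.

Lemma form_mx_re_im : form_mx = toC form_re + 'i%C *: toC form_im.
Proof. by apply/matrixP => i j; rewrite !mxE -complexE. Qed.

Lemma form_mx_tr : form_mx^T = - form_mx.
Proof.
apply/matrixP => i j; rewrite !mxE.
have := alt (tperm ord0 ord_max) (pair_index i j).
rewrite odd_tperm /= expr1 mulN1r => <-; congr a; apply/ffunP => k.
rewrite !ffunE; case: tpermP => [->|->|k0 km] //.
by case: k k0 km => [[|[|//]]] lt k0 km; [case: k0|case: km]; exact: val_inj.
Qed.

Lemma sum_pair_index (F : {ffun 'I_2 -> 'I_N} -> C) :
  \sum_i F i = \sum_x \sum_y F (pair_index x y).
Proof.
rewrite pair_bigA (reindex (fun p => pair_index p.1 p.2)) //=.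
exists (fun i : {ffun 'I_2 -> 'I_N} => (i ord0, i ord_max)) => [[x y] _|i _] /=.
  by rewrite !ffunE.
apply/ffunP => k; rewrite !ffunE; case: eqP => [->|k0] //.
congr (i _); apply: val_inj; case: k k0 => [[|[|//]]] //= lt k0.
by case: k0; exact: val_inj.
Qed.

Lemma prod_ord2 (F : 'I_2 -> C) : \prod_k F k = F ord0 * F ord_max.
Proof. by rewrite big_ord_recl big_ord1; congr (_ * F _); exact: val_inj. Qed.

Lemma unlift_ord2 : unlift ord_max (ord0 : 'I_2) = Some ord0.
Proof.
by rewrite -[RHS](liftK (ord_max : 'I_2)); congr unlift; exact: val_inj.
Qed.

Lemma form_eval_pair (u : 'I_2 -> 'rV[C]_N) :
  form_eval a u = (u ord0 *m form_mx *m (u ord_max)^T) 0 0.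
Proof.
rewrite /form_eval sum_pair_index exchange_big [RHS]mxE.
apply: eq_bigr => y _; rewrite !mxE mulr_suml; apply: eq_bigr => x _.
by rewrite prod_ord2 !ffunE /= !mxE mulrA [a _ * _]mulrC.
Qed.

Lemma contract_pair (e : 'rV[C]_N) :
  Defs.contract a (fun _ : 'I_1 => e) = e *m form_mx.
Proof.
apply/rowP => j; rewrite !mxE /form_eval sum_pair_index.
apply: eq_bigr => x _; rewrite (bigD1 j) //= [X in _ + X]big1 ?addr0.
  by rewrite prod_ord2 unlift_ord2 unlift_none !ffunE /= !mxE !eqxx mulr1 mulrC.
move=> y /negPf yj; rewrite prod_ord2 unlift_ord2 unlift_none !ffunE /= !mxE eqxx yj.
by rewrite !mulr0.
Qed.

Lemma form_mx_T01 m (B : 'M[C]_(m, N)) : B *m Z0 = 0 -> B *m form_mx = 0.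
Proof.
move=> BZ; apply/row_matrixP => k; rewrite row0 row_mul -contract_pair.
apply/rowP => j; rewrite !mxE.
apply: (a10 (k := ord0)); rewrite unlift_ord2; apply: in_T01_Z0.
by rewrite -row_mul BZ row0.
Qed.

Lemma form_mx_Z0_W0 : Z0 *m W0 *m form_mx = 2 *: form_mx.
Proof.
apply/eqP; rewrite -subr_eq0 -mul_scalar_mx -mulmxBl; apply/eqP/form_mx_T01.
by rewrite mulmxBl -mulmxA W0_Z0 mul_mx_scalar mul_scalar_mx subrr.
Qed.

Lemma J_form_mx : toC J *m form_mx = 'i%C *: form_mx.
Proof.
rewrite -[in LHS](half_two form_mx) -form_mx_Z0_W0 -scalemxAr !mulmxA J_Z0.
by rewrite -!scalemxAl scalerA mulrC -scalerA form_mx_Z0_W0 half_two.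
Qed.

Lemma form_re_tr : form_re^T = - form_re.
Proof.
rewrite map_trmx form_mx_tr; apply/matrixP => i j; rewrite !mxE.
by case: (a _).
Qed.

Lemma form_im_tr : form_im^T = - form_im.
Proof.
rewrite map_trmx form_mx_tr; apply/matrixP => i j; rewrite !mxE.
by case: (a _).
Qed.

Lemma Re_re_im (x y : R) : complex.Re (x%:C + 'i%C * y%:C) = x.
Proof. by rewrite /= mul0r mul1r subr0 addr0. Qed.

Lemma re_re_im_mx m k (A B : 'M[R]_(m, k)) :
  map_mx (@complex.Re R) (toC A + 'i%C *: toC B) = A.
Proof. by apply/matrixP => i j; rewrite !mxE Re_re_im. Qed.

Lemma re_im_mulmx m k l (A B : 'M[R]_(m, k)) (A' B' : 'M[R]_(k, l)) :
  (toC A + 'i%C *: toC B) *m (toC A' + 'i%C *: toC B')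
  = toC (A *m A' - B *m B') + 'i%C *: toC (A *m B' + B *m A').
Proof.
rewrite mulmxDl !mulmxDr -!scalemxAl -!scalemxAr scalerA mulii scaleN1r.
rewrite -!map_mxM map_mxB map_mxD scalerDr.
by rewrite ['i%C *: _ - _]addrC addrACA.
Qed.

(** A form of type (2,0) is complex linear, which links its real and imaginary
    parts. *)
Lemma J_form_re : J *m form_re = - form_im.
Proof.
have := congr1 (map_mx (@complex.Re R)) J_form_mx.
rewrite form_mx_re_im mulmxDr -scalemxAr -!map_mxM re_re_im_mx => ->.
rewrite scalerDr scalerA mulii scaleN1r -map_mxN addrC.
by rewrite re_re_im_mx.
Qed.

Lemma form_re_J : form_re *m J = form_im.
Proof.
have := congr1 trmx J_form_re; rewrite trmx_mul form_re_tr std_J_tr mulNmx mulmxN opprK.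
by rewrite linearN /= form_im_tr opprK.
Qed.

Lemma form_re_anticomm : form_re *m J = - (J *m form_re).
Proof. by rewrite form_re_J J_form_re opprK. Qed.

Variable G : 'M[R]_N.
Hypothesis Gsym : G^T = G.
Hypothesis GJ : J *m G *m J^T = G.
Hypothesis Gpos : forall v : 'rV[R]_N, v != 0 -> 0 < (v *m G *m v^T) 0 0.
Hypothesis avcp : forall e : 'I_1 -> 'rV[C]_N, (forall k, in_T10 (e k)) ->
  (forall k l, herm_dot G (e k) (e l) = (k == l)%:R) ->
  conorm G (Defs.contract a e) = Num.sqrt 2 ^+ 2.

Lemma polarize_mx m (Q : 'M[C]_m) :
  (forall u : 'rV[C]_m, (u *m Q *m adjmx u) 0 0 = 0) -> Q = 0.
Proof.
move=> Q0.
have QE (i j : 'I_m) : Q i j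
    = ((delta_mx 0 i : 'rV[C]_m) *m Q *m adjmx (delta_mx 0 j : 'rV[C]_m)) 0 0.
  rewrite -rowE mxE (bigD1 j) //= adjmxE !mxE !eqxx conjc1 mulr1 big1 ?addr0 //.
  by move=> k /negPf kj; rewrite !mxE kj andbF conjc0 mulr0.
apply/matrixP => i j; rewrite mxE; apply: (@polarize _ _ (Q j i)) => s.
have := Q0 (delta_mx 0 i + s *: delta_mx 0 j).
rewrite adjmxD adjmxZ !mulmxDl !mulmxDr -!scalemxAl -!scalemxAr.
have quad (t u : C) (A B D F : 'M[C]_1) :
    (A + t *: B + (u *: D + u *: (t *: F))) 0 0
    = A 0 0 + t * B 0 0 + (u * D 0 0 + u * (t * F 0 0)) by rewrite !mxE.
have Qd k : Q k k = 0 by rewrite QE Q0.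
by rewrite quad -!QE !Qd !mulr0 add0r addr0.
Qed.

Let K : 'M[C]_N := form_mx *m toC (invmx G) *m adjmx form_mx - 4 *: toC G.

(* The norm condition, extended from unit vectors by scaling and polarized. *)
Let W0_K_Z0 : W0 *m K *m Z0 = 0.
Proof.
apply: polarize_mx => u; have [->|u0] := eqVneq u 0.
  by rewrite !mul0mx mxE.
pose h := herm_dot G (u *m W0) (u *m W0).
have h0 : 0 < h by rewrite /h herm_dot_W0 herm_pos.
have cs : conjc (sqrtc h) = sqrtc h.
  by apply: CrealP; rewrite ger0_real // sqrtc_ge0 ltW.
have hs : h = sqrtc h * sqrtc h by rewrite -expr2 sqr_sqrtc.
have s0 : sqrtc h != 0 by rewrite sqrtc_eq0 gt_eqF.
pose e := (sqrtc h)^-1 *: (u *m W0).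
have e10 (k : 'I_1) : in_T10 e by rewrite /e scalemxAl; exact: in_T10_W0.
have eo (k l : 'I_1) : herm_dot G e e = (k == l)%:R.
  rewrite !ord1 eqxx /herm_dot -/(adjmx e) adjmxZ -!scalemxAl -scalemxAr scalerA.
  rewrite mxE -/(herm_dot G (u *m W0) (u *m W0)) -/h conjc_inv cs -invfM -hs.
  by rewrite mulVf // gt_eqF.
have := vcp_herm_dot Gsym GJ Gpos a10 avcp e10 eo.
rewrite contract_pair /herm_dot -/(adjmx _) /e -!scalemxAl adjmxZ -scalemxAr.
rewrite scalerA mxE conjc_inv cs -invfM -hs => E.
have -> : u *m (W0 *m K *m Z0) *m adjmx u = u *m W0 *m K *m adjmx (u *m W0).
  by rewrite adjmxM adj_W0 !mulmxA.
have -> : (u *m W0 *m K *m adjmx (u *m W0)) 0 0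
    = (u *m W0 *m form_mx *m toC (invmx G) *m adjmx (u *m W0 *m form_mx)) 0 0
      - 4 * h.
  rewrite /K mulmxBr mulmxBl [LHS]mxE; congr (_ + _).
    by rewrite [adjmx (u *m W0 *m form_mx)]adjmxM !mulmxA.
  by rewrite mxE -scalemxAr -scalemxAl mxE.
have hn : h != 0 by rewrite gt_eqF.
apply: (mulfI (invr_neq0 hn)); rewrite mulr0 mulrBr E mulrCA mulVf //; ring.
Qed.

Let sandwich (B : 'M[C]_N) : Z0 *m W0 *m B = 2 *: B ->
  B *m toC (invmx G) *m adjmx B
  = 4^-1 *: (Z0 *m (W0 *m (B *m toC (invmx G) *m adjmx B) *m Z0) *m W0).
Proof.
move=> ZWB; have BZW : adjmx B *m Z0 *m W0 = 2 *: adjmx B.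
  have := congr1 (@adjmx R _ _) ZWB.
  by rewrite !adjmxM adj_W0 adj_Z0 adjmxZ conjc_nat mulmxA.
rewrite !mulmxA ZWB -!mulmxA [adjmx B *m _]mulmxA BZW -!scalemxAr -!scalemxAl.
rewrite !scalerA (_ : 4^-1 * (2 * 2) = 1 :> C) ?scale1r //.
by rewrite -natrM mulVf // pnatr_eq0.
Qed.

Lemma form_mx_metric :
  form_mx *m toC (invmx G) *m adjmx form_mx = 2 *: (toC G *m Z0 *m W0).
Proof.
rewrite (sandwich form_mx_Z0_W0).
have -> : W0 *m (form_mx *m toC (invmx G) *m adjmx form_mx) *m Z0
    = 4 *: (W0 *m toC G *m Z0).
  have := W0_K_Z0; rewrite /K mulmxBr mulmxBl => /eqP; rewrite subr_eq0 => /eqP ->.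
  by rewrite -scalemxAr -scalemxAl.
have GC : toC G *m Z0 = Z0 *m cpx G by exact/mul_Z0_cpx/metric_J_comm.
rewrite -scalemxAr -scalemxAl scalerA mulVf ?pnatr_eq0 // scale1r.
rewrite -[W0 *m _ *m _]mulmxA GC [W0 *m _]mulmxA W0_Z0 mul_scalar_mx.
by rewrite -scalemxAr -scalemxAl.
Qed.

(** The real part of the polarized norm condition: the contributions of the real
    and imaginary parts of the form agree because these differ by the complex
    structure. *)
Lemma form_re_metric : form_re *m invmx G *m form_re = - G.
Proof.
have := congr1 (map_mx (@complex.Re R)) form_mx_metric.
have -> : 2 *: (toC G *m Z0 *m W0)
    = toC (2 *: G) + 'i%C *: toC (- (2 *: (G *m J))).
  rewrite -mulmxA Z0_W0 mulmxBr mulmx1 -scalemxAr -map_mxM.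
  by apply/matrixP => i j; rewrite !mxE !(rmorphM, rmorphN) rmorph_nat /=; ring.
rewrite re_re_im_mx.
have -> : adjmx form_mx = toC (- form_re) + 'i%C *: toC form_im.
  rewrite form_mx_re_im adjmxD adjmxZ !adjmx_real form_re_tr form_im_tr.
  by rewrite conj_i !map_mxN scalerN scaleNr opprK.
have -> : form_mx *m toC (invmx G)
    = toC (form_re *m invmx G) + 'i%C *: toC (form_im *m invmx G).
  by rewrite form_mx_re_im mulmxDl -scalemxAl -!map_mxM.
rewrite re_im_mulmx re_re_im_mx -{1}form_re_J.
have -> : form_im = - (J *m form_re) by rewrite J_form_re opprK.
rewrite !mulmxN -!mulmxA [J *m (invmx G *m _)]mulmxA -(inv_metric_J_comm GJ Gpos).
rewrite -!mulmxA [J *m (J *m _)]mulmxA std_JJ mulNmx mul1mx !mulmxN opprK.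
rewrite -opprD -mulr2n -scaler_nat -scalerN => /(scalerI _) E.
by rewrite -[LHS]opprK E // pnatr_eq0.
Qed.

End SymplecticPoint.

(** * The Levi-Civita connection of a Kaehler metric *)

Section KahlerAlgebra.
Variables (R : realType) (n : nat).
Local Notation N := (n + n)%N.
Local Notation J := (std_J R n).

(** Row a of the complex structure is sg a times the basis vector swp a. *)
Definition swp (a : 'I_N) : 'I_N :=
  match fintype.split a with inl j => rshift n j | inr j => lshift n j end.
Definition sg (a : 'I_N) : R := if fintype.split a is inl _ then 1 else - 1.

Lemma split_cases (P : 'I_N -> Prop) :
  (forall j, P (lshift n j)) -> (forall j, P (rshift n j)) -> forall a, P a.
Proof. by move=> Pl Pr a; rewrite -(splitK a); case: (fintype.split a). Qed.

Lemma split_l (j : 'I_n) : fintype.split (lshift n j) = inl j.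
Proof. exact: (unsplitK (inl j)). Qed.

Lemma split_r (j : 'I_n) : fintype.split (rshift n j) = inr j.
Proof. exact: (unsplitK (inr j)). Qed.

Lemma swpK : involutive swp.
Proof. by apply: split_cases => j; rewrite /swp !(split_l, split_r). Qed.

Lemma sg_swp a : sg (swp a) = - sg a.
Proof.
by move: a; apply: split_cases => j; rewrite /sg /swp !(split_l, split_r) ?opprK.
Qed.

Lemma sg_sq a : sg a * sg a = 1.
Proof. by rewrite /sg; case: (fintype.split a) => _; rewrite ?mulrNN mulr1. Qed.

Lemma row_std_J a : row a J = sg a *: delta_mx 0 (swp a).
Proof.
move: a; apply: split_cases => j; rewrite /sg /swp !(split_l, split_r).
  rewrite scale1r /std_J /block_mx rowKu row_row_mx row0 row1.
  by rewrite delta_mx_rshift.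
rewrite /std_J /block_mx rowKd row_row_mx row0 scaleN1r linearN /= row1.
by rewrite delta_mx_lshift opp_row_mx oppr0.
Qed.

Lemma mul_J_entry (B : 'M[R]_N) a b : (J *m B) a b = sg a * B (swp a) b.
Proof.
have -> : (J *m B) a b = row a (J *m B) 0 b by rewrite [RHS]mxE.
by rewrite row_mul row_std_J -scalemxAl -rowE !mxE.
Qed.

Lemma mul_entry_J (B : 'M[R]_N) a b : (B *m J) a b = - (sg b * B a (swp b)).
Proof.
have -> : (B *m J) a b = (B *m J)^T b a by rewrite [RHS]mxE.
by rewrite trmx_mul std_J_tr mulNmx mxE mul_J_entry mxE.
Qed.

Variables (G : 'M[R]_N) (dG : 'I_N -> 'M[R]_N).
Hypothesis GJ : G *m J = J *m G.
Hypothesis Gu : G \in unitmx.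
Hypothesis Gsym : G^T = G.
Hypothesis dG_sym : forall k, (dG k)^T = dG k.
Hypothesis dG_J : forall k, dG k *m J = J *m dG k.
Hypothesis closed : forall i j k,
  (J *m dG i) j k + (J *m dG j) k i + (J *m dG k) i j = 0.

(** The Christoffel symbols with the last index lowered. *)
Definition lowered (k : 'I_N) : 'M[R]_N :=
  \matrix_(j, m) (2^-1 * (dG k j m + dG j k m - dG m k j)).

Definition gam (k : 'I_N) : 'M[R]_N := lowered k *m invmx G.

Lemma dG_symE k i j : dG k i j = dG k j i.
Proof. by rewrite -[in LHS]dG_sym mxE. Qed.

Lemma gam_metric k : gam k *m G = lowered k.
Proof. by rewrite /gam mulmxKV. Qed.

Lemma metric_compat k : dG k = gam k *m G + G *m (gam k)^T.
Proof.
have -> : G *m (gam k)^T = (lowered k)^T by rewrite -gam_metric [RHS]trmx_mul Gsym.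
rewrite gam_metric; apply/matrixP => i j; rewrite !mxE.
rewrite (dG_symE k j i) (dG_symE j k i) (dG_symE i k j) (dG_symE j i k) (dG_symE i j k).
by field.
Qed.

Lemma gam_symE k a l : gam k a l = gam a k l.
Proof.
rewrite !mxE; apply: eq_bigr => m _; congr (_ * _); rewrite !mxE.
by rewrite (dG_symE m k a) [dG k a m + _]addrC.
Qed.

(** The Kaehler condition: the cyclic identity for the triples (a, b, k) and
    (Ja, Jb, k) gives the antisymmetry of the lowered symbols. *)
Lemma lowered_J k : lowered k *m J = J *m lowered k.
Proof.
apply/matrixP => a b; rewrite mul_entry_J mul_J_entry !mxE.
have st m i j : sg i * dG m (swp i) j = - (sg j * dG m i (swp j)).
  by rewrite -mul_J_entry -mul_entry_J dG_J.
have := closed a b k; rewrite !mul_J_entry (st b k a) => c1.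
have := closed (swp a) (swp b) k; rewrite !mul_J_entry !swpK !sg_swp.
have -> : sg k * dG (swp b) (swp k) (swp a) = sg a * dG (swp b) k a.
  by rewrite st swpK sg_swp mulNr opprK.
move/(congr1 (fun t => - (sg a * sg b) * t)); rewrite mulr0 => c2.
have := st k a b => c3.
have c2' : sg a * dG (swp a) b k - sg b * dG (swp b) k a
    + sg b * dG k a (swp b) = 0.
  rewrite -c2; have := sg_sq a; have := sg_sq b.
  move: (sg a) (sg b) (dG (swp a) b k) (dG (swp b) k a) (dG k a (swp b)).
  by move=> p q u v w q2 p2; ring: q2 p2.
rewrite (dG_symE a k) (dG_symE (swp a) k b).
move: c1 c2' c3; rewrite (dG_symE k (swp a)).
set d1 := dG a _ _; set d2 := dG b _ _; set d3 := dG k b _; set d4 := dG k _ _.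
set d5 := dG (swp a) _ _; set d6 := dG (swp b) _ _.
move=> c1 c2' c3.
lra.
Qed.

Lemma gam_J k : gam k *m J = J *m gam k.
Proof.
rewrite /gam -mulmxA.
have -> : invmx G *m J = J *m invmx G.
  apply: (can_inj (mulKmx Gu)); rewrite mulKVmx // mulmxA GJ mulmxK //.
by rewrite !mulmxA lowered_J.
Qed.

(** The connection matrices are complex linear also in the direction of
    differentiation, because nabla is torsion free. *)
Lemma gam_swp k : sg k *: gam (swp k) = gam k *m J.
Proof.
apply/matrixP => a l; rewrite mxE gam_symE -mul_J_entry -gam_J !mul_entry_J.
by rewrite gam_symE.
Qed.

End KahlerAlgebra.

(** * Tensor calculus in a chart *)

Lemma open_chart_img (R : realType) (N : nat) (M : topologicalType)
  (A : smoothAtlas R N M) (c : chart_index A) : open (chart_img c).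
Proof. exact: chart_img_open. Qed.
Arguments open_chart_img {R N M A} c.

Section ChartCalculus.
Variables (R : realType) (n : nat) (M : topologicalType).
Local Notation C := R[i].
Local Notation N := (n + n)%N.
Local Notation toC := (map_mx (real_complex R)).
Local Notation J := (std_J R n).
Local Notation W0 := (W0 R n).
Local Notation Z0 := (Z0 R n).
Variables (A : smoothAtlas R N M) (g : matrixField A).
Hypothesis g_kahler : kahler g.
Variable c : chart_index A.

Lemma chart_img_ind (P : 'rV[R]_N -> M -> Prop) :
  (forall y, chart_dom c y -> P (chart c y) y) ->
  forall z, chart_img c z -> P z (chart_inv c z).
Proof. by move=> Py z [y cy <-]; rewrite chartK //; exact: Py. Qed.

Lemma metric_sym_at x : chart_dom c x -> (g c x)^T = g c x.
Proof. by case: g_kahler => _ [[[]]]; auto. Qed.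

Lemma metric_J_at x : chart_dom c x -> J *m g c x *m J^T = g c x.
Proof. by case: g_kahler => _ [[_]]; auto. Qed.

Lemma metric_pos_at x : chart_dom c x ->
  forall v : 'rV[R]_N, v != 0 -> 0 < (v *m g c x *m v^T) 0 0.
Proof. by case: g_kahler => _ [[[]]]; auto. Qed.

Lemma metric_unit_at x : chart_dom c x -> g c x \in unitmx.
Proof. by move=> cx; exact/metric_unit/metric_pos_at. Qed.

Variable x : M.
Hypothesis cx : chart_dom c x.
Let z0 : 'rV[R]_N := chart c x.

Let z0U : chart_img c z0. Proof. by exists x. Qed.

Lemma partial_on k (f h : 'rV[R]_N -> R) :
  (forall z, chart_img c z -> f z = h z) -> partial k f z0 = partial k h z0.
Proof. exact: (derive_eq_on (open_chart_img c) _ z0U). Qed.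

Lemma cpartial_on k (f h : 'rV[R]_N -> C) :
  (forall z, chart_img c z -> f z = h z) -> cpartial k f z0 = cpartial k h z0.
Proof.
by move=> fh; rewrite /cpartial; congr (_ +i* _); apply: partial_on => z /fh ->.
Qed.

Lemma pderivable_smooth k (f : 'rV[R]_N -> R) :
  smooth_on (chart_img c) f -> pderivable k z0 f.
Proof. by move=> /(_ 1%N)[/(_ _ z0U) df _]; exact: diff_derivable. Qed.

Lemma cpderivable_smooth k (f : 'rV[R]_N -> C) :
  csmooth_on (chart_img c) f -> cpderivable k z0 f.
Proof. by move=> [fr fi]; split; exact: pderivable_smooth. Qed.

Lemma pderivable_mx k (B : matrixField A) : smooth_matrixField B ->
  forall i j, pderivable k z0 (fun z => B c (chart_inv c z) i j).
Proof.
move=> sB i j; apply: pderivable_smooth => l.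
exact: (Ck_on_entry (open_chart_img c) i j (sB c l)).
Qed.

Definition dmx (B : matrixField A) k : 'M[R]_N :=
  dermx (fun f => partial k f z0) (fun z => B c (chart_inv c z)).

Lemma dmx_on k (B : matrixField A) (F : 'rV[R]_N -> 'M[R]_N) :
  (forall z, chart_img c z -> B c (chart_inv c z) = F z) ->
  dmx B k = dermx (fun f => partial k f z0) F.
Proof.
move=> BF; apply/matrixP => i j; rewrite !mxE; apply: partial_on => z /BF ->.
by [].
Qed.

Let dd k := partial_derivation k z0.

Lemma metric_smooth_at : smooth_matrixField g.
Proof. by case: g_kahler => _ [[[]]]. Qed.

Let gd k i j : pderivable k z0 (fun z => g c (chart_inv c z) i j).
Proof. exact: (pderivable_mx metric_smooth_at). Qed.

Lemma dmx_mull k (B : matrixField A) (L : 'M[R]_N) : smooth_matrixField B ->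
  dermx (fun f => partial k f z0) (fun z => L *m B c (chart_inv c z))
  = L *m dmx B k.
Proof.
move=> sB; rewrite (dermx_mul (dd k)).
- by rewrite (dermx_cst (dd k)) mul0mx add0r.
- by move=> i j; exact: (der_dom_cst (dd k)).
- by move=> i j; exact: pderivable_mx.
Qed.

Lemma dmx_mulr k (B : matrixField A) (L : 'M[R]_N) : smooth_matrixField B ->
  dermx (fun f => partial k f z0) (fun z => B c (chart_inv c z) *m L)
  = dmx B k *m L.
Proof.
move=> sB; rewrite (dermx_mul (dd k)).
- by rewrite (dermx_cst (dd k)) mulmx0 addr0.
- by move=> i j; exact: pderivable_mx.
- by move=> i j; exact: (der_dom_cst (dd k)).
Qed.

Lemma dmetric_sym k : (dmx g k)^T = dmx g k.
Proof.
apply/matrixP => i j; rewrite !mxE; apply: partial_on.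
apply: (chart_img_ind (P := fun z y => g c y j i = g c y i j)) => y cy.
by rewrite -[in LHS](metric_sym_at cy) mxE.
Qed.

Lemma dmetric_J k : dmx g k *m J = J *m dmx g k.
Proof.
rewrite -(dmx_mull k J metric_smooth_at) -(dmx_mulr k J metric_smooth_at).
apply/matrixP => i j; rewrite !mxE; apply: partial_on.
apply: (chart_img_ind (P := fun z y => (g c y *m J) i j = (J *m g c y) i j)).
by move=> y cy; rewrite (metric_J_comm (metric_J_at cy)).
Qed.

Lemma dmetric_closed i j k :
  (J *m dmx g i) j k + (J *m dmx g j) k i + (J *m dmx g k) i j = 0.
Proof.
have E a b d : (J *m dmx g a) b d
    = partial a (fun y => kahler_form g c (chart_inv c y) b d) z0.
  by rewrite -(dmx_mull a J metric_smooth_at) [LHS]mxE.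
have [_ [_ H]] := g_kahler; apply: etrans (H c x cx i j k).
by congr (_ + _ + _); exact: E.
Qed.

Definition conn k : 'M[R]_N := \matrix_(j, l) metric_christoffel g c l k j x.

Lemma connE k : conn k = gam (g c x) (dmx g) k.
Proof.
apply/matrixP => j l; rewrite !mxE /metric_christoffel /christoffel mulr_sumr.
apply: eq_bigr => m _; rewrite [lowered _ _ _ _]mxE ![dmx _ _ _ _]mxE /= chartK //.
have -> : invmx (g c x) l m = invmx (g c x) m l.
  by rewrite -[in LHS](metric_sym_at cx) -trmx_inv mxE.
by rewrite [X in _ * X = _]mulrC mulrA; reflexivity.
Qed.

Let gJ := metric_J_comm (metric_J_at cx).
Let gu := metric_unit_at cx.

Lemma conn_metric k : dmx g k = conn k *m g c x + g c x *m (conn k)^T.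
Proof. by rewrite connE; exact: (metric_compat gu (metric_sym_at cx) dmetric_sym). Qed.

Lemma conn_J k : conn k *m J = J *m conn k.
Proof.
rewrite connE.
exact: (gam_J gJ gu dmetric_sym dmetric_J dmetric_closed).
Qed.

Lemma conn_swp k : sg R k *: conn (swp k) = conn k *m J.
Proof.
rewrite !connE.
exact: (gam_swp gJ gu dmetric_sym dmetric_J dmetric_closed).
Qed.

Lemma conn_r j : conn (rshift n j) = conn (lshift n j) *m J.
Proof. by rewrite -conn_swp /sg /swp split_l scale1r. Qed.

(** The matrix of the covariant derivative of an endomorphism field. *)
Definition nabla_mx (B : matrixField A) k : 'M[R]_N :=
  dmx B k + B c x *m conn k - conn k *m B c x.

Lemma nabla_mxE B k j i : nabla_endo g B c x k j i = nabla_mx B k j i.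
Proof.
rewrite !mxE; congr (_ + _ - _); apply: eq_bigr => l _; by rewrite mxE.
Qed.

(** The metric is parallel, so lowering an index commutes with nabla. *)
Lemma nabla_lower (B : matrixField A) k : smooth_matrixField B ->
  dermx (fun f => partial k f z0) (fun z => B c (chart_inv c z) *m g c (chart_inv c z))
    - conn k *m (B c x *m g c x) - (B c x *m g c x) *m (conn k)^T
  = nabla_mx B k *m g c x.
Proof.
move=> sB; rewrite (dermx_mul (dd k)); do ?exact: pderivable_mx; last exact: gd.
rewrite -/(dmx B k) -/(dmx g k) {1 2}/z0 chartK // conn_metric /nabla_mx.
rewrite mulmxBl mulmxDl mulmxDr !mulmxA addrA [LHS]addrAC addrK.
by [].
Qed.

End ChartCalculus.

(** * Degree two: the quaternionic structure *)

Section QuaternionDimension.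
Variables (R : realType) (n : nat) (B : 'M[R]_(n + n)).
Local Notation C := R[i].
Local Notation toC := (map_mx (real_complex R)).
Local Notation J := (std_J R n).
Local Notation W0 := (W0 R n).

(** An endomorphism anticommuting with the complex structure is antilinear,
    with a complex matrix b such that b * conj b = -1; so |det b|^2 = (-1)^n. *)
Lemma quaternion_even : B *m J = - (J *m B) -> B *m B = - 1%:M -> ~~ odd n.
Proof.
move=> BJ BB; pose cj m k := @map_mx _ _ (@conjc R) m k.
have cj_real m k (D : 'M[R]_(m, k)) : cj m k (toC D) = toC D.
  by apply/matrixP => i j; rewrite !mxE; exact: conjc_real.
have cjK m k (D : 'M[C]_(m, k)) : cj m k (cj m k D) = D.
  by apply/matrixP => i j; rewrite !mxE; exact: conjcK.
have cjM m k l (D : 'M[C]_(m, k)) (D' : 'M[C]_(k, l)) :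
    cj m l (D *m D') = cj m k D *m cj k l D' by exact: map_mxM.
pose X := cj n (n + n)%N W0 *m toC B.
have XJ : X *m toC J = 'i%C *: X.
  rewrite /X -mulmxA -map_mxM BJ map_mxN mulmxN map_mxM mulmxA.
  have -> : cj n (n + n)%N W0 *m toC J = - ('i%C *: cj n (n + n)%N W0).
    rewrite -(cj_real _ _ J) -cjM W0_J; apply/matrixP => i j.
    by rewrite !mxE conjcM conj_i mulNr.
  by rewrite mulNmx opprK -scalemxAl.
have XE := type10_row XJ; set b := lsubmx X in XE.
have WB : W0 *m toC B = cj n n b *m cj n (n + n)%N W0.
  by rewrite -cjM -XE /X cjM cjK cj_real.
have bb : cj n n b *m b = - 1%:M.
  have E : - W0 = cj n n b *m b *m W0.
    have -> : - W0 = W0 *m toC B *m toC B.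
      by rewrite -mulmxA -map_mxM BB map_mxN map_mx1 mulmxN mulmx1.
    by rewrite WB -[LHS]mulmxA -/X XE mulmxA.
  have := congr1 (fun D => D *m Z0 R n) E.
  rewrite mulNmx -[RHS]mulmxA W0_Z0 mul_mx_scalar => /(congr1 (fun D => 2^-1 *: D)).
  by rewrite half_two scalerN -(scalemx1 _ 2) half_two.
apply/negP => on; have := congr1 determinant bb.
rewrite det_mulmx det_map_mx -scaleN1r detZ det1 mulr1 -signr_odd on expr1.
move=> E; have := mulcJ_ge0 (\det b); rewrite mulrC.
have -> : (\det b)^*%C * \det b = -1 by exact: E.
by rewrite ler0N1.
Qed.

(** If D and J D both anticommute with B, as does J, then D also commutes with
    the invertible B. *)
Lemma anticomm_twice (D : 'M[R]_(n + n)) :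
  B *m J = - (J *m B) -> B *m B = - 1%:M ->
  D *m B + B *m D = 0 -> J *m D *m B + B *m (J *m D) = 0 -> D = 0.
Proof.
move=> BJ BB DB JDB.
have E : D *m B = B *m D.
  have JE : J *m (D *m B - B *m D) = 0.
    by rewrite mulmxBr -JDB !mulmxA BJ mulNmx.
  apply/eqP; rewrite -subr_eq0; apply/eqP; apply: oppr_inj.
  rewrite oppr0; transitivity (J *m (J *m (D *m B - B *m D))).
    by rewrite [RHS]mulmxA std_JJ mulNmx mul1mx.
  by rewrite JE mulmx0.
have D2 : 2 *: (D *m B) = 0 by rewrite scaler_nat mulr2n {2}E.
have /eqP := D2; rewrite scaler_eq0 pnatr_eq0 /= => /eqP DB0.
by rewrite -[D]mulmx1 -[1%:M]opprK -BB mulmxN mulmxA DB0 mul0mx oppr0.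
Qed.

End QuaternionDimension.

Section Hyperkahler.
Variables (R : realType) (n : nat) (M : topologicalType).
Local Notation C := R[i].
Local Notation N := (n + n)%N.
Local Notation toC := (map_mx (real_complex R)).
Local Notation J := (std_J R n).
Variables (A : smoothAtlas R N M) (g : matrixField A) (phi : formField 2 A).
Hypothesis g_kahler : kahler g.
Hypothesis phi_vcp : complex_vcp (r := 1) g phi.

Let phi10 c x : chart_dom c x -> forall (e : 'I_2 -> 'rV[C]_N) k,
  in_T01 (e k) -> form_eval (phi c x) e = 0.
Proof. by move=> cx; case: phi_vcp => [[[_ H] _] _]; exact: (H c x cx). Qed.

Let phi_alt c x : chart_dom c x -> alternating_form (phi c x).
Proof. by move=> cx; case: phi_vcp => [[[[_ H _] _] _] _]; exact: (H c x cx). Qed.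

Let phi_norm c x (cx : chart_dom c x) := phi_vcp.2 c x cx.

Definition re_field : matrixField A := fun c x => form_re (phi c x).
Definition im_field : matrixField A := fun c x => form_im (phi c x).
(** The real part of the form with one index raised by the metric. *)
Definition second_structure : matrixField A :=
  fun c x => re_field c x *m invmx (g c x).
(** In the row-vector convention the relation K *m B *m J = - 1 forces
    K = - (J *m B). *)
Definition third_structure : matrixField A :=
  fun c x => - J *m second_structure c x.
Local Notation S := re_field.
Local Notation B := second_structure.
Local Notation K := third_structure.

Section At.
Variables (c : chart_index A) (x : M).
Hypothesis cx : chart_dom c x.
Let gsym := metric_sym_at g_kahler cx.
Let gJ := metric_J_at g_kahler cx.
Let gpos := metric_pos_at g_kahler cx.
Let gu := metric_unit_at g_kahler cx.

Lemma second_metric : B c x *m g c x = S c x.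
Proof. by rewrite /second_structure mulmxKV. Qed.

Lemma second_sq : B c x *m B c x = - 1%:M.
Proof.
rewrite /second_structure !mulmxA.
rewrite (form_re_metric (phi10 cx) (phi_alt cx) gsym gJ gpos (phi_norm cx)).
by rewrite mulNmx mulmxV.
Qed.

Lemma second_anticomm : B c x *m J = - (J *m B c x).
Proof.
rewrite /second_structure -mulmxA (inv_metric_J_comm gJ gpos) mulmxA.
by rewrite (form_re_anticomm (phi10 cx) (phi_alt cx)) mulNmx mulmxA.
Qed.

Lemma second_orth : B c x *m g c x *m (B c x)^T = g c x.
Proof.
have E : (B c x)^T = - (invmx (g c x) *m S c x).
  rewrite /second_structure trmx_mul trmx_inv gsym.
  by rewrite (form_re_tr (phi_alt cx)) mulmxN.
rewrite second_metric E mulmxN mulmxA.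
by rewrite (form_re_metric (phi10 cx) (phi_alt cx) gsym gJ gpos (phi_norm cx)) opprK.
Qed.

Lemma third_sq : K c x *m K c x = - 1%:M.
Proof.
rewrite /third_structure !mulNmx mulmxN opprK -mulmxA [B c x *m (J *m _)]mulmxA.
rewrite second_anticomm mulNmx mulmxN -mulmxA second_sq mulmxA std_JJ.
by rewrite mulmxN mulmx1 opprK.
Qed.

Lemma third_orth : K c x *m g c x *m (K c x)^T = g c x.
Proof.
have E (D G : 'M[R]_N) : D *m G *m D^T = G -> J *m G *m J^T = G ->
    (- J *m D) *m G *m (- J *m D)^T = G.
  move=> DG JG; rewrite mulNmx linearN /= mulmxN !mulNmx opprK trmx_mul.
  by rewrite -[RHS]JG -[in RHS]DG !mulmxA.
exact: E second_orth gJ.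
Qed.

Lemma quaternion_rel : K c x *m B c x *m J = - 1%:M.
Proof.
by rewrite /third_structure -[- J *m _ *m _]mulmxA second_sq mulmxN mulmx1 opprK std_JJ.
Qed.

End At.

Lemma re_field_smooth : smooth_matrixField S.
Proof.
move=> c k; apply: (Ck_on_mx (open_chart_img c)) => i j.
have [[[[fs _ _] _] _] _] := phi_vcp; have [rs _] := fs c (pair_index i j).
by apply: (Ck_on_eq (open_chart_img c)) (rs k) => z _; rewrite /= !mxE.
Qed.

Lemma second_smooth : smooth_matrixField B.
Proof.
move=> c k; apply: (Ck_on_mulmx (open_chart_img c)) (re_field_smooth c k) _.
apply: (Ck_on_invmx (open_chart_img c)); last exact: (metric_smooth_at g_kahler).
apply: (chart_img_ind (P := fun _ y => g c y \in unitmx)).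
exact: metric_unit_at.
Qed.

Lemma third_smooth : smooth_matrixField K.
Proof.
move=> c k; apply: (Ck_on_mulmx (open_chart_img c)) (second_smooth c k).
exact: (Ck_on_cst (open_chart_img c)).
Qed.

Lemma second_transition c c' x : chart_dom c x -> chart_dom c' x ->
  B c x *m transition_jac c c' x = transition_jac c c' x *m B c' x.
Proof.
move=> cx c'x; set T := transition_jac c c' x.
have gT : g c x = T *m g c' x *m T^T.
  by have [_ [[[_ gt _ _] _] _]] := g_kahler; exact: gt.
have ST : S c x = T *m S c' x *m T^T.
  have FT : form_mx (phi c x) = toC T *m form_mx (phi c' x) *m toC T^T.
    apply/matrixP => i j; rewrite mxE.
    have [[[[_ _ ft] _] _] _] := phi_vcp.
    rewrite (ft _ _ _ cx c'x) form_eval_pair !ffunE /= -/T !map_row.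
    rewrite -row_mul tr_row -map_trmx !mxE; apply: eq_bigr => k _.
    by rewrite !mxE.
  have FT' : form_mx (phi c x) = toC (T *m S c' x *m T^T)
      + 'i%C *: toC (T *m im_field c' x *m T^T).
    rewrite FT form_mx_re_im mulmxDr mulmxDl -scalemxAr -scalemxAl.
    by rewrite -!map_mxM.
  by rewrite {1}/re_field /form_re FT' re_re_im_mx.
have Tu : T \in unitmx.
  have := metric_unit_at g_kahler cx; rewrite gT !unitmx_mul.
  by case/andP => /andP[].
have gu' := metric_unit_at g_kahler c'x.
have TTu : T^T \in unitmx by rewrite unitmx_tr.
apply: (can_inj (mulmxK gu')); apply: (can_inj (mulmxK TTu)).
rewrite -[in RHS](mulmxA T) second_metric // -ST -[RHS](second_metric cx).
by rewrite gT !mulmxA.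
Qed.

Lemma third_transition c c' x : chart_dom c x -> chart_dom c' x ->
  K c x *m transition_jac c c' x = transition_jac c c' x *m K c' x.
Proof.
move=> cx c'x; rewrite /third_structure -mulmxA (second_transition cx c'x).
have [/(_ c c' x cx c'x) JT _] := g_kahler.
by rewrite !mulmxA mulNmx JT mulmxN.
Qed.

Section Parallel.
Variables (c : chart_index A) (x : M).
Hypothesis cx : chart_dom c x.
Local Notation conn := (conn g c x).
Let z0 : 'rV[R]_N := chart c x.

(** Holomorphy of the components: the derivative along J d_j of the real part
    is determined by the derivative along d_j. *)
Lemma dre_r j : dmx c x S (rshift n j) = J *m dmx c x S (lshift n j).
Proof.
have E : dmx c x im_field (lshift n j) = - (J *m dmx c x S (lshift n j)).
  rewrite -mulNmx -(dmx_mull cx _ (- J) re_field_smooth); apply: (dmx_on cx).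
  apply: (chart_img_ind (P := fun _ y => im_field c y = - J *m re_field c y)).
  by move=> y cy; rewrite mulNmx (J_form_re (phi10 cy)) opprK.
apply/oppr_inj; rewrite -E; apply/matrixP => a b; rewrite !mxE.
have [[_ /(_ c x cx j (pair_index a b)) H] _] := phi_vcp.
have := congr1 (fun t : C => complex.Im (2 * t)) H.
rewrite /dzbar mulrA mulfV ?two_neq0 // mul1r mulr0 /=.
rewrite mul0r mul1r add0r => /eqP; rewrite addr_eq0 => /eqP imE.
under [X in - partial _ X _]eq_fun do rewrite !mxE.
under [X in _ = partial _ X _]eq_fun do rewrite !mxE.
by rewrite imE.
Qed.

Lemma second_lower k : nabla_mx g c x B k *m g c x
  = dmx c x S k - conn k *m S c x - S c x *m (conn k)^T.
Proof.
have SE : dmx c x S k = dermx (fun f => partial k f z0)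
    (fun z => B c (chart_inv c z) *m g c (chart_inv c z)).
  apply: (dmx_on cx).
  apply: (chart_img_ind (P := fun _ y => S c y = B c y *m g c y)) => y cy.
  by rewrite second_metric.
by rewrite -(nabla_lower g_kahler cx k second_smooth) SE (second_metric cx).
Qed.

(** Holomorphy of the form, as a statement about the covariant derivative. *)
Lemma second_nabla_r j :
  nabla_mx g c x B (rshift n j) = J *m nabla_mx g c x B (lshift n j).
Proof.
apply: (can_inj (mulmxK (metric_unit_at g_kahler cx))).
rewrite -[RHS]mulmxA [LHS]second_lower [in RHS]second_lower dre_r.
rewrite (conn_r g_kahler cx).
have SJ : S c x *m J = - (J *m S c x).
  exact: form_re_anticomm (phi10 cx) (phi_alt cx).
have E (P Q : 'M[R]_N) : P *m J = - (J *m P) ->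
    P *m (Q *m J)^T = J *m (P *m Q^T).
  move=> PJ; rewrite trmx_mul std_J_tr mulNmx mulmxN (mulmxA P) PJ mulNmx opprK.
  by rewrite mulmxA.
rewrite (E _ _ SJ) (conn_J g_kahler cx) -[J *m conn _ *m _]mulmxA.
by rewrite -!mulmxBr.
Qed.

(** The covariant derivative of the constant B *m B = - 1. *)
Lemma second_nabla_anticomm k :
  nabla_mx g c x B k *m B c x + B c x *m nabla_mx g c x B k = 0.
Proof.
pose dd := partial_derivation k z0.
have Bd := pderivable_mx (k := k) cx second_smooth.
have dBB : dmx c x B k *m B c x + B c x *m dmx c x B k = 0.
  have := dermx_mul dd Bd Bd; rewrite /= chartK // => <-.
  rewrite -(dermx_cst dd (- 1%:M)); apply/matrixP => a b.
  rewrite [LHS]mxE [RHS]mxE; apply: (partial_on cx).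
  apply: (chart_img_ind (P := fun _ y => (B c y *m B c y) a b = (- 1%:M) a b)).
  by move=> y cy; rewrite second_sq.
rewrite /nabla_mx mulmxBl mulmxBr mulmxDl mulmxDr.
move: dBB => /eqP; rewrite addr_eq0 => /eqP ->.
rewrite -[conn k *m B c x *m B c x]mulmxA [B c x *m (B c x *m conn k)]mulmxA.
rewrite second_sq // mulmxN mulNmx mulmx1 mul1mx opprK -[B c x *m conn k *m _]mulmxA.
have cancel (X Y Z : 'M[R]_N) : - X + Y + Z + (X - Z - Y) = 0; last exact: cancel.
have -> : X - Z - Y = - (- X + Y + Z) by rewrite !opprD opprK addrAC.
exact: subrr.
Qed.

Lemma second_parallel k : nabla_mx g c x B k = 0.
Proof.
have left0 j : nabla_mx g c x B (lshift n j) = 0.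
  apply: (anticomm_twice (second_anticomm cx) (second_sq cx)).
    exact: second_nabla_anticomm.
  by rewrite -second_nabla_r second_nabla_anticomm.
by move: k; apply: split_cases => j; rewrite ?second_nabla_r left0 ?mulmx0.
Qed.

Lemma third_parallel k : nabla_mx g c x K k = 0.
Proof.
have E (D P Q : 'M[R]_N) : Q *m J = J *m Q ->
    - J *m D + - J *m P *m Q - Q *m (- J *m P) = - J *m (D + P *m Q - Q *m P).
  by move=> QJ; rewrite mulmxBr mulmxDr !mulmxA mulmxN QJ !mulNmx.
rewrite /nabla_mx (_ : dmx c x K k = - J *m dmx c x B k); last first.
  exact: (dmx_mull cx k (- J) second_smooth).
rewrite (E _ _ _ (conn_J g_kahler cx k)).
have -> : dmx c x B k + B c x *m conn k - conn k *m B c x = 0.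
  exact: second_parallel.
exact: mulmx0.
Qed.

Lemma complex_structure_parallel k :
  nabla_mx g c x (fun _ _ => J) k = 0.
Proof.
rewrite /nabla_mx /dmx (dermx_cst (partial_derivation k (chart c x))) add0r.
by rewrite (conn_J g_kahler cx) subrr.
Qed.

End Parallel.

Lemma vcp1_hyperkahler : [set: M] !=set0 -> hyperkahler g.
Proof.
move=> [x0 _]; split; first by case: g_kahler => _ [[? _] _].
split.
  have [c cx] := chart_cover A x0.
  have := quaternion_even (second_anticomm cx) (second_sq cx) => en.
  exists n./2; rewrite -[in LHS](odd_double_half n) (negPf en) add0n.
  by rewrite addnn -!mul2n mulnA.
exists (fun _ _ => J), B, K; split; [split|split; [split|]].
- split=> [c k|c c' x cx c'x]; first exact: (Ck_on_cst (open_chart_img c)).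
  by case: g_kahler => H _; exact: H.
- by split; [exact: second_smooth|exact: second_transition].
- by split; [exact: third_smooth|exact: third_transition].
- by move=> c x cx k j i; rewrite nabla_mxE complex_structure_parallel // mxE.
- by move=> c x cx k j i; rewrite nabla_mxE second_parallel // mxE.
- by move=> c x cx k j i; rewrite nabla_mxE third_parallel // mxE.
move=> c x cx; split; split.
- exact: (metric_J_at g_kahler cx).
- exact: second_orth.
- exact: third_orth.
- exact: std_JJ.
- exact: second_sq.
- exact: third_sq.
- exact: quaternion_rel.
Qed.

End Hyperkahler.

(** * Top degree: the parallel volume form *)

Section ConjugateDerivative.
Variables (R : realType) (N : nat) (k : 'I_N) (z : 'rV[R]_N).

Lemma cpartial_conj (f : 'rV[R]_N -> R[i]) : cpderivable k z f ->
  cpderivable k z (fun y => conjc (f y)) /\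
  cpartial k (fun y => conjc (f y)) z = conjc (cpartial k f z).
Proof.
move=> [fr fi]; have reE : (fun y => complex.Re (conjc (f y)))
    = (fun y => complex.Re (f y)) by apply/funext => y; case: (f y).
have imE : (fun y => complex.Im (conjc (f y)))
    = (fun y => - complex.Im (f y)) by apply/funext => y; case: (f y).
split; last by rewrite /cpartial reE imE partialN.
split; first by rewrite reE.
rewrite /pderivable imE; exact: (derivableN fi).
Qed.

End ConjugateDerivative.

Section CalabiYau.
Variables (R : realType) (r : nat) (M : topologicalType).
Local Notation C := R[i].
Local Notation n := r.+1.
Local Notation N := (n + n)%N.
Local Notation toC := (map_mx (real_complex R)).
Local Notation J := (std_J R n).
Local Notation W0 := (W0 R n).
Local Notation Z0 := (Z0 R n).
Variables (A : smoothAtlas R N M) (g : matrixField A) (phi : formField n A).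
Hypothesis g_kahler : kahler g.
Hypothesis phi_vcp : complex_vcp (r := r) g phi.

Let phi10 c x : chart_dom c x -> forall (e : 'I_n -> 'rV[C]_N) k,
  in_T01 (e k) -> form_eval (phi c x) e = 0.
Proof. by move=> cx; case: phi_vcp => [[[_ H] _] _]; exact: (H c x cx). Qed.

Let phi_alt c x : chart_dom c x -> alternating_form (phi c x).
Proof. by move=> cx; case: phi_vcp => [[[[_ H _] _] _] _]; exact: (H c x cx). Qed.

Variables (c : chart_index A) (x : M).
Hypothesis cx : chart_dom c x.
Local Notation conn := (conn g c x).
Let z0 : 'rV[R]_N := chart c x.
Let f (z : 'rV[R]_N) : C := top_comp (phi c (chart_inv c z)).
Let H (z : 'rV[R]_N) : 'M[C]_n := herm (g c (chart_inv c z)).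
Let f0 : C := top_comp (phi c x).

Let norm_at y : chart_dom c y ->
  2 ^+ n * (top_comp (phi c y) * conjc (top_comp (phi c y)))
  = \det (herm (g c y)).
Proof.
move=> cy; have [_ vcp] := phi_vcp.
exact: (top_norm (phi10 cy) (phi_alt cy) (metric_sym_at g_kahler cy)
  (metric_J_at g_kahler cy) (metric_pos_at g_kahler cy) (vcp c y cy)).
Qed.

Lemma top_comp_neq0 : f0 != 0.
Proof.
have [E] := unitary_frame (metric_sym_at g_kahler cx) (metric_pos_at g_kahler cx).
move/(congr1 determinant); rewrite !det_mulmx -(norm_at cx) -/f0 det1.
by apply: contra_eq_neq => ->; rewrite !(mul0r, mulr0) eq_sym oner_eq0.
Qed.

Let dd k := cpartial_derivation k z0.

Let fd k : cpderivable k z0 f.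
Proof.
apply: (cpderivable_smooth cx); have [[[[fs _ _] _] _] _] := phi_vcp.
exact: fs.
Qed.

Let gCd k i j : cpderivable k z0 (fun z => toC (g c (chart_inv c z)) i j).
Proof.
have gd : pderivable k z0 (fun z => g c (chart_inv c z) i j).
  by exact: (pderivable_mx cx (metric_smooth_at g_kahler)).
split; under eq_fun do rewrite mxE; first exact: gd.
exact: derivable_cst.
Qed.

Let cst k m p (B : 'M[C]_(m, p)) i j : cpderivable k z0 (fun=> B i j).
Proof. exact: (der_dom_cst (dd k) (B i j)). Qed.

Let WGd k i j : cpderivable k z0 (fun z => (W0 *m toC (g c (chart_inv c z))) i j).
Proof. exact: (der_dom_mulmx (dd k) (cst k W0) (gCd k)). Qed.

Let Hd k i j : cpderivable k z0 (fun z => H z i j).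
Proof. exact: (der_dom_mulmx (dd k) (WGd k) (cst k Z0)). Qed.

(** The metric is parallel, and the connection is complex linear. *)
Let dH k : dermx (fun h => cpartial k h z0) H
  = cpx (conn k) *m herm (g c x) + herm (g c x) *m adjmx (cpx (conn k)).
Proof.
have dg : dermx (fun h => cpartial k h z0) (fun z => toC (g c (chart_inv c z)))
    = toC (dmx c x g k).
  apply/matrixP => i j; rewrite !mxE /cpartial.
  under [X in partial k X z0 +i* _]eq_fun do rewrite mxE.
  under [X in _ +i* partial k X z0]eq_fun do rewrite mxE.
  rewrite /=; congr (_ +i* _); exact: derive_cst.
have -> : dermx (fun h => cpartial k h z0) H = W0 *m toC (dmx c x g k) *m Z0.
  rewrite (dermx_mul (dd k) (WGd k) (cst k Z0)).
  rewrite (dermx_mul (dd k) (cst k W0) (gCd k)).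
  by rewrite !(dermx_cst (dd k)) mulmx0 addr0 mul0mx add0r dg.
have E (P Q : 'M[R]_N) (B : 'M[C]_n) : W0 *m toC P = B *m W0 ->
    W0 *m toC (P *m Q + Q *m P^T) *m Z0
    = B *m (W0 *m toC Q *m Z0) + W0 *m toC Q *m Z0 *m adjmx B.
  move=> PB; have PZ : toC P^T *m Z0 = Z0 *m adjmx B.
    by rewrite -adj_W0 -adjmxM -PB adjmxM adjmx_real.
  rewrite map_mxD !map_mxM mulmxDr mulmxDl !mulmxA PB -!mulmxA.
  by congr (_ + _ *m (_ *m _)).
rewrite (conn_metric g_kahler cx); exact: E (mul_W0_cpx (conn_J g_kahler cx k)).
Qed.

(** The top component of nabla_k phi. *)
Let theta k : C := cpartial k f z0 - \tr (cpx (conn k)) * f0.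

(** The derivative of the relation 2^n |f|^2 = det H. *)
Let theta_imaginary k : theta k * conjc f0 + f0 * conjc (theta k) = 0.
Proof.
have two : (2 ^+ n : C) != 0 by rewrite expf_neq0 // two_neq0.
have [df cdf] := cpartial_conj (fd k).
have fx : f z0 = f0 by rewrite /f /z0 chartK.
have := @cpartial_on _ _ _ _ _ _ cx k (fun z => 2 ^+ n * (f z * conjc (f z)))
  (fun z => \det (H z)).
have Hx : H z0 = herm (g c x) by rewrite /H /z0 chartK.
rewrite (der_det (dd k) (Hd k)) dH Hx.
rewrite mulmxDl mxtraceD mxtrace_mul_adjr mxtrace_mul_adjl -(norm_at cx) -/f0.
have -> : \tr (adjmx (cpx (conn k))) = conjc (\tr (cpx (conn k))).
  by rewrite mxtrace_tr /mxtrace rmorph_sum; apply: eq_bigr => i _; rewrite mxE.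
rewrite (der_mul (dd k) (der_dom_cst (dd k) _) (der_dom_mul (dd k) (fd k) df)).
rewrite (der_cst (dd k)) mul0r add0r (der_mul (dd k) (fd k) df) cdf fx.
move=> E; apply: (mulfI two); rewrite mulr0 /theta.
rewrite conjcD conjcN conjcM.
have {}E := E (chart_img_ind (P := fun z y => 2 ^+ n * (top_comp (phi c y) *
  conjc (top_comp (phi c y))) = \det (herm (g c y))) norm_at).
transitivity (2 ^+ n * (cpartial k f z0 * conjc f0 + f0 * conjc (cpartial k f z0))
  - (\tr (cpx (conn k)) + conjc (\tr (cpx (conn k)))) * (2 ^+ n * (f0 * conjc f0))).
  by ring.
by rewrite E; ring.
Qed.

(** Holomorphy: theta is a form of type (1,0). *)
Let theta_r j : theta (rshift n j) = 'i%C * theta (lshift n j).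
Proof.
have fE : cpartial (rshift n j) f z0 = 'i%C * cpartial (lshift n j) f z0.
  have [[_ /(_ c x cx j [ffun k => lshift n k]) E] _] := phi_vcp.
  have := congr1 (fun t : C => 'i%C * (2 * t)) E.
  rewrite /dzbar [2 * (_ * _)]mulrA mulfV ?two_neq0 // mul1r !mulr0 mulrDr mulrA mulii.
  by rewrite mulN1r => /eqP; rewrite subr_eq0 => /eqP ->.
have cE : cpx (conn (rshift n j)) = 'i%C *: cpx (conn (lshift n j)).
  rewrite /cpx (conn_r g_kahler cx) map_mxM mulmxA -[_ *m toC J *m _]mulmxA J_Z0.
  by rewrite -scalemxAr scalerA mulrC -scalerA.
by rewrite /theta fE cE mxtraceZ mulrBr mulrA.
Qed.

(** For theta of type (1,0), the vanishing of the real part of theta / f in the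
    directions v and J v makes theta vanish. *)
Lemma top_parallel k : cpartial k f z0 = \tr (cpx (conn k)) * f0.
Proof.
suff theta0 j : theta (lshift n j) = 0.
  apply/eqP; rewrite -subr_eq0 -/(theta k); apply/eqP.
  by move: k; apply: split_cases => j; rewrite ?theta_r theta0 ?mulr0.
have H1 := theta_imaginary (lshift n j); have H2 := theta_imaginary (rshift n j).
move: H2; rewrite theta_r conjcM conj_i => H2.
have : theta (lshift n j) * conjc f0 = 0.
  apply: (@polarize_1_i _ _ (f0 * conjc (theta (lshift n j)))) => //.
  by apply: oppr_inj; rewrite oppr0 -[RHS]H2; ring.
move/eqP; rewrite mulf_eq0 conjc_eq0 (negPf top_comp_neq0) orbF => /eqP.
by [].
Qed.

(** The sum over the slots is an infinitesimal change of basis, which acts on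
    the determinant by the trace. *)
Lemma sum_dz_det k (i : {ffun 'I_n -> 'I_N}) :
  \sum_(s < n) \sum_(l < N) (conn k (i s) l)%:C
    * dz_det R [ffun t => if t == s then l else i t]
  = \tr (cpx (conn k)) * dz_det R i.
Proof.
pose Mi : 'M[C]_n := \matrix_(t, j) Z0 (i t) j.
rewrite /dz_det -/Mi -mxtrace_mul_adjl -sum_det_replace_row.
apply: eq_bigr => s _.
have rowl (l : 'I_N) : \det (\matrix_(t, j) Z0 ([ffun t => if t == s then l else i t] t) j)
    = \sum_j Z0 l j * cofactor Mi s j.
  rewrite -det_replace_row; congr determinant; apply/matrixP => a b.
  by rewrite !mxE ffunE; case: eqP.
have -> : \matrix_(t, j) (if t == s then (Mi *m cpx (conn k)) t j else Mi t j)
    = \matrix_(t, j) (if t == s then (Mi *m cpx (conn k)) s j else Mi t j).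
  by apply/matrixP => a b; rewrite [LHS]mxE [RHS]mxE; case: eqP => [->|].
rewrite det_replace_row; under eq_bigr => l _ do rewrite rowl mulr_sumr.
rewrite exchange_big; apply: eq_bigr => j _ /=.
under eq_bigr => l _ do rewrite mulrA.
rewrite -mulr_suml; congr (_ * _).
have -> : (Mi *m cpx (conn k)) s j = (Z0 *m cpx (conn k)) (i s) j.
  by rewrite !mxE; apply: eq_bigr => l _; rewrite [Mi _ _]mxE.
rewrite -(mul_Z0_cpx (conn_J g_kahler cx k)) [RHS]mxE.
by apply: eq_bigr => l _; rewrite [toC _ _ _]mxE.
Qed.

Lemma vcp_top_parallel k i : nabla_form g phi c x k i = 0.
Proof.
have dE : cpartial k (fun y => phi c (chart_inv c y) i) z0
    = dz_det R i * cpartial k f z0.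
  have -> : cpartial k (fun y => phi c (chart_inv c y) i) z0
      = cpartial k (fun y => dz_det R i * f y) z0.
    apply: (cpartial_on cx).
    apply: (chart_img_ind (P := fun _ y => phi c y i = dz_det R i * top_comp (phi c y))).
    by move=> y cy; exact: (top_components (phi10 cy) (phi_alt cy)).
  rewrite (der_mul (dd k) (der_dom_cst (dd k) _) (fd k)).
  by rewrite (der_cst (dd k)) mul0r add0r.
rewrite /nabla_form -/z0 dE top_parallel.
under eq_bigr => s _ do under eq_bigr => l _ do
  rewrite (top_components (phi10 cx) (phi_alt cx)) mulrA.
under eq_bigr => s _ do rewrite -mulr_suml.
rewrite -mulr_suml -/f0.
have -> : \sum_(s < n) \sum_(l < N) (metric_christoffel g c l k (i s) x)%:C *
    dz_det R [ffun t => if t == s then l else i t] = \tr (cpx (conn k)) * dz_det R i.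
  rewrite -sum_dz_det; apply: eq_bigr => s _; apply: eq_bigr => l _.
  by rewrite [conn k _ _]mxE.
by ring.
Qed.

End CalabiYau.

Lemma vcp_top_calabi_yau (R : realType) (r : nat) (M : topologicalType)
    (A : smoothAtlas R (r.+1 + r.+1) M) (g : matrixField A)
    (phi : formField r.+1 A) :
  kahler g -> complex_vcp (r := r) g phi -> calabi_yau g.
Proof.
move=> gk vcp; split=> //; exists phi; split; last first.
  by move=> c x cx k i; exact: vcp_top_parallel.
split; first by case: vcp => [[]].
by move=> c x cx; eexists; exact: (top_comp_neq0 gk vcp cx).
Qed.

(** * The dichotomy *)

Theorem theorem26 (R : realType) (n r : nat) (M : topologicalType)
    (A : smoothAtlas R (n + n)%N M) (g : matrixField A)
    (phi : formField r.+1 A)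
    (M_nonempty : [set: M] !=set0)
    (M_hausdorff : hausdorff_space M)
    (M_compact : compact [set: M])
    (g_kahler : kahler g)
    (r_ge1 : (1 <= r)%N)
    (r_le_n : (r <= n)%N)
    (phi_vcp : complex_vcp g phi) :
  (r = (n - 1)%N /\ calabi_yau g) \/ (r = 1%N /\ hyperkahler g).
Proof.
have [x0 _] := M_nonempty; have [c cx] := chart_cover A x0.
have [[[fform f10] _] vcp] := phi_vcp.
have alt : alternating_form (phi c x0) by exact: (form_alternating fform cx).
have gsym := metric_sym_at g_kahler cx; have gpos := metric_pos_at g_kahler cx.
have [E EH] := unitary_frame gsym gpos.
have bvcp := vcp_pullback gsym (metric_J_at g_kahler cx) gpos (f10 c x0 cx)
  (vcp c x0 cx) (frame_unitary EH) (frame_type10 E).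
have balt := pullback_alternating_form (E *m W0 R n) alt.
have two : (2 ^+ r.+1 : R[i]) != 0 by rewrite expf_neq0 // two_neq0.
case: r r_ge1 r_le_n phi phi_vcp {fform f10 vcp alt} bvcp balt two
  => [//|[|q]] _ rn phi phi_vcp bvcp balt two.
  by right; split=> //; exact: vcp1_hyperkahler phi_vcp M_nonempty.
have [nE|nr] := eqVneq n q.+2.
  by subst n; move: two; rewrite (vcp_top_degree bvcp balt) eqxx.
have [nE|nr1] := eqVneq n q.+3.
  by subst n; left; split; [rewrite subn1|exact: vcp_top_calabi_yau phi_vcp].
have qn : (q + 4 <= n)%N by lia.
by have := middle_degree_absurd qn balt bvcp two.
Qed.
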